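(* Let $A\in\{1,\dots,k\}$, $k\ge 2$, and let $\psi=(\psi_1,\dots,\psi_k)\in\mathbb{R}^k$ be defined by $\int \mu_a(x)\,d\mathbb{P}(x)=\psi_0+\psi_a$, $a=1,\dots,k$, where the intercept $\psi_0\in\mathbb{R}$ is known. Assume exact sparsity $\|\psi\|_0\le s$. Let $\widehat\psi$ be either the Lasso estimator $\widehat\psi_{\text{lasso}}$ or the best subset selection estimator $\widehat\psi_{\text{subset}}$ (defined in the context). Assume that for all $a\in\{1,\dots,k\}$: (i) $\frac{c}{k}\le \varpi_a=\mathbb{P}(A=a)\le\frac{C}{k}$; (ii) $|\widehat\varpi_a/\widehat\pi_a(X)|\le B$ almost surely; (iii) $|\widehat\mu_a(X)|,\ |Y|,\ |\psi_0|\le B$ almost surely, for constants $c,C,B>0$ independent of $k$ and $n$. Assume further that $\delta_n(a)\le\delta_n$ and $\epsilon_n(a)\le\epsilon_n$ for all $a\in\{1,\dots,k\}$. Then, whenever $n\ge\max\{\gamma k,\ s^4/k^2\}\log k$ for a large enough constant $\gamma$, $$\mathbb{E}\left(\sum_{a=1}^k\varpi_a(\widehat\psi_a-\psi_a)^2\right)\lesssim s\,\frac{\log k}{n}+\frac{s}{k}(\delta_n\epsilon_n)^2 .$$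
   Context: $Z=(X,A,Y)\sim\mathbb{P}$ with covariates $X\in\mathbb{R}^d$, treatment $A\in\{1,\dots,k\}$, outcome $Y\in\mathbb{R}$. $D_1$ and $D_2$ are two independent samples, each of $n$ i.i.d. copies of $Z$; $\mathbb{P}_n^2$ denotes the sample average over $D_2$. $\mu_a(x)=\mathbb{E}(Y\mid X=x,A=a)$, $\pi_a(x)=\mathbb{P}(A=a\mid X=x)$, with $\pi_a(x)>0$ for all $a$. $\widehat\mu_a,\widehat\pi_a$ are (arbitrary) estimators of $\mu_a,\pi_a$ constructed from $D_1$ only, and $\widehat\varpi_a$ is the proportion of observations in $D_1$ with treatment $a$. For a function $f$ of $x$ (possibly depending on $D_1$, which is held fixed), $\|f\|=(\int f(x)^2\,d\mathbb{P}(x))^{1/2}$, and $$\delta_n(a)=\left\|\frac{\pi_a}{\widehat\pi_a}-1\right\|,\qquad \epsilon_n(a)=\|\mu_a-\widehat\mu_a\|.$$ $\delta_n,\epsilon_n$ are non-random. For vectors, $\|v\|_1=\sum_j|v_j|$ and $\|v\|_0=\#\{j:v_j\ne0\}$. The empirical risk is, for $\beta\in\mathbb{R}^k$, $$\widehat R(\beta)=\mathbb{P}_n^2\left\{-2\sum_{a=1}^k\left[\frac{\mathbf 1(A=a)}{\widehat\pi_a(X)}\{Y-\widehat\mu_a(X)\}+\widehat\mu_a(X)-\psi_0\right]\beta_a\widehat\varpi_a+\beta_A^2\right\}.$$ The estimators are $\widehat\psi_{\text{lasso}}\in\arg\min_{\|\beta\|_1\le t}\widehat R(\beta)$ with constraint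 level chosen as the true value $t=\|\psi\|_1$, and $\widehat\psi_{\text{subset}}\in\arg\min_{\|\beta\|_0\le s}\widehat R(\beta)$. $\lesssim$ means inequality up to a multiplicative constant not depending on $n,k,s,\delta_n,\epsilon_n$ (it may depend on the constants in the assumptions).
   Formalization: If some treatment is absent from D_2, the best subset argmin may be empty or unbounded and the bound can fail; there the formal version sets the absent treatments' coordinates of the subset estimator to 0, and the whole estimator to 0 if no minimiser exists. *)

(* Defs.v *)
From HB Require Import structures.
From mathcomp Require Import all_boot all_order all_algebra.
From mathcomp Require Import all_classical all_reals all_analysis.

Set Implicit Arguments.
Unset Strict Implicit.
Unset Printing Implicit Defensive.

Import Order.TTheory GRing.Theory Num.Theory.
Import numFieldNormedType.Exports.

Local Open Scope classical_set_scope.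
Local Open Scope ring_scope.

(* A [measurableType] must be inhabited, so the treatments are the elements of
   'I_k.+1 and there are k.+1 of them. *)
HB.instance Definition _ (k : nat) := isPointed.Build 'I_k.+1 ord0.
HB.instance Definition _ (k : nat) := @isMeasurable.Build default_measure_display
  'I_k.+1 (@discrete_measurable 'I_k.+1) (@discrete_measurable0 _)
  (@discrete_measurableC _) (@discrete_measurableU _).

(* [d.-tuple R] carries the product sigma-algebra, i.e. the Borel one of R^d;
   an observation is ((X, A), Y). *)
Notation covariate R d := (d.-tuple (measurableTypeR R)) (only parsing).
Notation observation R d k :=
  (covariate R d * 'I_k.+1 * measurableTypeR R)%type (only parsing).

Section Observations.
Context {R : realType} {d k : nat}.

Definition cov (z : observation R d k) : covariate R d := z.1.1.
Definition trt (z : observation R d k) : 'I_k.+1 := z.1.2.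
Definition outcome (z : observation R d k) : R := z.2.

Definition treatment_prob (Q : probability (observation R d k) R)
  (a : 'I_k.+1) : R := fine (Q [set z | trt z = a]).

Definition L2norm (Q : probability (observation R d k) R)
  (f : covariate R d -> R) : \bar R := ('N[Q]_2%:E[EFin \o (f \o cov)])%E.

End Observations.

Section ConditionalExpectation.
Context {R : realType} {d d' : measure_display}.
Context {T : measurableType d} {T' : measurableType d'}.

(* m is a version of v |-> E(W | V = v) under Q. *)
Definition is_cond_expectation (Q : probability T R) (V : T -> T')
    (W : T -> R) (m : T' -> R) : Prop :=
  [/\ measurable_fun [set: T'] m,
      Q.-integrable [set: T] (EFin \o (m \o V)) &
      forall E : set T', measurable E ->
        (\int[Q]_(z in V @^-1` E) (m (V z))%:E =
         \int[Q]_(z in V @^-1` E) (W z)%:E)%E].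

End ConditionalExpectation.

Section IidSamples.
Context {R : realType} {d d' : measure_display}.
Context {Omega : measurableType d} {T : measurableType d'}.

Definition mutually_independent (P : probability Omega R) (I : finType)
    (W : I -> Omega -> T) : Prop :=
  forall (J : {set I}) (E : I -> set T), (forall i, measurable (E i)) ->
    (P (\bigcap_(i in [set` J]) (W i @^-1` E i)) =
     \prod_(i in J) P (W i @^-1` E i))%E.

Definition pooled (n : nat) (D1 D2 : Omega -> n.-tuple T)
    (i : 'I_n + 'I_n) : Omega -> T :=
  match i with
  | inl j => fun w => tnth (D1 w) j
  | inr j => fun w => tnth (D2 w) j
  end.

(* The 2n observations are mutually independent with common law Q; this is
   the same as D1 and D2 being independent, each made of n i.i.d. draws. *)
Definition independent_iid_samples (P : probability Omega R)
    (Q : probability T R) (n : nat) (D1 D2 : Omega -> n.-tuple T) : Prop :=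
  mutually_independent P (pooled D1 D2) /\
  forall (i : 'I_n + 'I_n) (E : set T), measurable E ->
    P (pooled D1 D2 i @^-1` E) = Q E.

End IidSamples.

Section EmpiricalRisk.
Context {R : realType} {d k n : nat}.

Definition sample_mean (D : n.-tuple (observation R d k))
    (f : observation R d k -> R) : R :=
  n%:R^-1 * \sum_(i < n) f (tnth D i).

Definition treatment_freq (D : n.-tuple (observation R d k))
    (a : 'I_k.+1) : R :=
  sample_mean D (fun z => (trt z == a)%:R).

(* An estimator of a family (f_a) of functions of the covariates is a map
   sending a treatment, a sample and a covariate value to a real number. *)
Definition estimator : Type :=
  'I_k.+1 -> n.-tuple (observation R d k) -> covariate R d -> R.

Definition measurable_estimator (f : estimator) : Prop :=
  forall a, measurable_fun
    [set: (n.-tuple (observation R d k) * covariate R d)%type]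
    (fun u : (n.-tuple (observation R d k) * covariate R d)%type =>
       f a u.1 u.2).

Definition empirical_risk (psi0 : R) (muhat pihat : estimator)
    (D1 D2 : n.-tuple (observation R d k)) (beta : 'I_k.+1 -> R) : R :=
  sample_mean D2 (fun z =>
    - 2 * (\sum_(a < k.+1)
        ((trt z == a)%:R / pihat a D1 (cov z)
             * (outcome z - muhat a D1 (cov z))
           + muhat a D1 (cov z) - psi0) * beta a * treatment_freq D1 a)
    + beta (trt z) ^+ 2).

End EmpiricalRisk.
Arguments estimator : clear implicits.

Section Estimators.
Context {R : realType} {k : nat}.

Definition l1norm (v : 'I_k -> R) : R := \sum_(a < k) `|v a|.
Definition l0norm (v : 'I_k -> R) : nat := #|[set a | v a != 0]%SET|.

Definition argmin (C : set ('I_k -> R)) (F : ('I_k -> R) -> R) :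
    set ('I_k -> R) :=
  [set beta | C beta /\ forall beta', C beta' -> F beta <= F beta'].

Definition lasso_argmin (t : R) (F : ('I_k -> R) -> R) : set ('I_k -> R) :=
  argmin [set beta | l1norm beta <= t] F.

Definition subset_argmin (s : nat) (F : ('I_k -> R) -> R) : set ('I_k -> R) :=
  argmin [set beta | (l0norm beta <= s)%N] F.

End Estimators.

(* If every treatment occurs in D2 the risk is strictly convex, a minimiser
   under the l0 constraint exists, and this says exactly that b is one.
   Otherwise the risk is affine in the coordinates of the treatments missing
   from D2: it may be unbounded below, or constant in such a coordinate, so that
   the set of minimisers is empty or unbounded.  In that case b is still a
   minimiser if there is one, the coordinates of the missing treatments being
   0 (setting them to 0 keeps a minimiser a minimiser), and b = 0 if there is
   no minimiser.  No such convention is needed for the lasso, whose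
   constraint set is compact. *)
Definition is_subset_estimate (R : realType) (d k n s : nat)
    (D2 : n.-tuple (observation R d k)) (F : ('I_k.+1 -> R) -> R)
    (b : 'I_k.+1 -> R) : Prop :=
  (subset_argmin s F !=set0 ->
     subset_argmin s F b /\
     forall a, (forall i, trt (tnth D2 i) != a) -> b a = 0) /\
  (subset_argmin s F = set0 -> forall a, b a = 0).

(* Main.v *)
Require Import Defs.
From HB Require Import structures.
From mathcomp Require Import all_boot all_order all_algebra.
From mathcomp Require Import all_classical all_reals all_analysis.
From mathcomp Require Import measurable_realfun ring lra.

Set Implicit Arguments.
Unset Strict Implicit.
Unset Printing Implicit Defensive.

Import Order.TTheory GRing.Theory Num.Theory.
Import numFieldNormedType.Exports.

Local Open Scope classical_set_scope.
Local Open Scope ring_scope.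

(** The empirical risk is the quadratic function
      sum_a (q_a b_a^2 - 2 th_a b_a),
    where q_a is the frequency of treatment a in D2 and th_a the mean over D2
    of the doubly robust pseudo-outcome of a, weighted by its frequency in D1
    ([empirical_riskE]).  Comparing the risks of the estimate b and of psi
    gives, for the error b - psi,
      sum_a q_a (b_a - psi_a)^2 <= 2 sum_a g_a (b_a - psi_a),
      g_a = th_a - q_a psi_a
    ([basic_inequality]).  For both estimators |b - psi|_1^2 is at most
    4 s |b - psi|_2^2, by the cone condition of the lasso, or because the error
    has at most 2 s nonzero coordinates.  If all q_a are at least of order
    1 / k, the loss is therefore at most of order k s max_a g_a^2
    ([loss_le_balanced]), and it is enough to show that max_a g_a^2 is of order
    ln k / (k n) + (delta_n epsilon_n / k)^2 on average.

    Given D1, g_a is a mean of n independent scores.  Their mean is small since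
    they are doubly robust: it is a product of the errors on pi_a and mu_a,
    bounded by the Cauchy-Schwarz inequality, plus psi_a times the error of the
    frequency of a in D1 ([score_mean_bound]).  Their second moment is of order
    1 / k ([score_second_moment]), so that Bernstein's inequality gives
    fluctuations of order sqrt (ln k / (k n)), uniformly in a
    ([exp_deviation_mean]).

    No tail is integrated.  The square of a deviation is bounded pointwise by a
    constant plus damped exponentials ([sqr_le_exp_tail]); the events that some
    treatment is too rare in D2 or too frequent in D1, where only the crude
    bound s n^2 on the loss is available ([loss_le_crude]), are replaced by
    exponentials as well ([imbalance]).  The loss is thus dominated almost
    surely by a linear combination of exponentials of sums ([ae_loss_le_bound])
    whose means factorise over the observations of one sample once the other
    sample is fixed ([prod_moment_le]).  The factorisation rests on the
    invariance of the law of the samples when one observation is redrawn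
    ([resample_integral]). *)

(** * Redrawing one observation of the samples *)

Section TuplePairs.
Context {d : measure_display} {T : measurableType d} {n : nat}.
Implicit Types (u : (n.-tuple T * n.-tuple T)%type).

Definition coordinate (i : 'I_n + 'I_n) u : T :=
  match i with inl j => tnth u.1 j | inr j => tnth u.2 j end.

(** The cylinders form a pi-system generating the product sigma-algebra, so
    that two finite measures on pairs of samples agree as soon as they agree
    on the cylinders; this is how independence, a property of rectangles of
    observations, reaches arbitrary events of the two samples. *)
Definition cylinder : set (set (n.-tuple T * n.-tuple T)) :=
  [set A | exists2 E : 'I_n + 'I_n -> set T, forall i, measurable (E i) &
     A = [set u | forall i, E i (coordinate i u)]].

Lemma measurable_coordinate i : measurable_fun [set: _] (coordinate i).
Proof.
case: i => j /=.
  exact: (measurableT_comp (measurable_tnth j) measurable_fst).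
exact: (measurableT_comp (measurable_tnth j) measurable_snd).
Qed.


Lemma cylinder_measurable A : cylinder A -> measurable A.
Proof.
move=> [E mE ->].
rewrite (_ : [set u | _] =
    \bigcap_(i in [set: 'I_n + 'I_n]) (coordinate i @^-1` E i)).
  apply: fin_bigcap_measurable => // i _; rewrite -[X in measurable X]setTI.
  exact: measurable_coordinate.
by apply/seteqP; split=> u /= h i; [move=> _|]; exact: h.
Qed.

Lemma cylinderI : setI_closed cylinder.
Proof.
move=> A B [E mE ->] [F mF ->]; exists (fun i => E i `&` F i).
  by move=> i; exact: measurableI.
apply/seteqP; split=> u /=.
  by move=> [h1 h2] i; split; [exact: h1|exact: h2].
by move=> h; split=> i; case: (h i).
Qed.

Lemma cylinder_coordinate i E : measurable E -> cylinder (coordinate i @^-1` E).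
Proof.
move=> mE; exists (fun j => if j == i then E else setT).
  by move=> j; case: ifP.
apply/seteqP; split=> u /=; first by move=> ? j; case: eqP => // ->.
by move/(_ i); rewrite eqxx.
Qed.

(** The identity is measurable from the sigma-algebra generated by the
    cylinders, since all its coordinates are. *)
Lemma measurable_cylinderE :
  @measurable _ (n.-tuple T * n.-tuple T)%type = <<s cylinder >>.
Proof.
apply/seteqP; split; last first.
  apply: smallest_sub; first exact: sigma_algebra_measurable.
  exact: cylinder_measurable.
pose idG (u : g_sigma_algebraType cylinder) : (n.-tuple T * n.-tuple T)%type := u.
suff midG : measurable_fun [set: _] idG.
  by move=> A mA; have := midG measurableT A mA; rewrite setTI.
have mc i : measurable_fun [set: g_sigma_algebraType cylinder] (coordinate i \o idG).
  move=> _ E mE; rewrite setTI; apply: sub_sigma_algebra.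
  exact: cylinder_coordinate.
apply/measurable_fun_pairP; split; apply/measurable_fun_tnthP => j.
  exact: (mc (inl j)).
exact: (mc (inr j)).
Qed.

Lemma cylinder_measure_unique (R : realType)
    (m1 m2 : {measure set (n.-tuple T * n.-tuple T)%type -> \bar R}) :
  (forall A, cylinder A -> m1 A = m2 A) -> (m1 setT < +oo)%E ->
  forall A, measurable A -> m1 A = m2 A.
Proof.
move=> m12 m1T; apply: (@measure_unique _ _ _ cylinder (fun=> setT)) => //.
- exact: measurable_cylinderE.
- exact: cylinderI.
- move=> _; exists (fun=> setT) => //.
  by apply/seteqP; split.
- by rewrite bigcup_const//; exists 0%N.
Qed.

End TuplePairs.
Arguments cylinder {d T n}.

Section Resampling.
Context {R : realType} {dO d : measure_display}.
Context {Omega : measurableType dO} {T : measurableType d} {n : nat}.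
Variables (P : probability Omega R) (Q : probability T R).
Variables (D1 D2 : Omega -> n.-tuple T).
Hypotheses (mD1 : measurable_fun [set: Omega] D1)
  (mD2 : measurable_fun [set: Omega] D2).
Hypothesis iid : independent_iid_samples P Q D1 D2.

Definition resample (i : 'I_n) (t : n.-tuple T) (z : T) : n.-tuple T :=
  [tuple if j == i then z else tnth t j | j < n].

Lemma tnth_resample i t z j :
  tnth (resample i t z) j = if j == i then z else tnth t j.
Proof. by rewrite tnth_mktuple. Qed.

Lemma measurable_resample i :
  measurable_fun [set: (n.-tuple T * T)%type] (fun u => resample i u.1 u.2).
Proof.
apply/measurable_fun_tnthP => j.
rewrite (_ : _ \o _ = (fun u => if j == i then u.2 else tnth u.1 j)); last first.
  by apply/funext => u /=; rewrite tnth_resample.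
case: eqP => _; first exact: measurable_snd.
exact: (measurableT_comp (measurable_tnth j) measurable_fst).
Qed.

Lemma iid_cylinder_probability (J : {set 'I_n + 'I_n}) (E : 'I_n + 'I_n -> set T) :
  (forall i, measurable (E i)) ->
  (P [set w | forall i, i \in J -> E i (coordinate i (D1 w, D2 w))] =
   \prod_(i in J) Q (E i))%E.
Proof.
move=> mE; have [ind law] := iid.
rewrite (eq_bigr (fun i => P (pooled D1 D2 i @^-1` E i))); last first.
  by move=> i _; rewrite law.
rewrite -ind//; congr (P _); apply/seteqP; split=> w /= h i /h.
  by case: i {h}.
by case: i {h}.
Qed.

(** Redrawing one observation of the second sample from Q, independently of
    everything else, does not change the joint law of the samples: the two
    laws give the same mass to every cylinder.  Tonelli then turns the law
    with the redrawn observation into an iterated integral, in which all the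
    other observations are held fixed. *)
Lemma resample_integral (i : 'I_n)
    (H : (n.-tuple T * n.-tuple T)%type -> \bar R) :
  measurable_fun [set: (n.-tuple T * n.-tuple T)%type] H -> (forall u, 0 <= H u)%E ->
  (\int[P]_w H (D1 w, D2 w) =
   \int[P]_w \int[Q]_z H (D1 w, resample i (D2 w) z))%E.
Proof.
move=> mH H0.
pose W w := (D1 w, D2 w).
pose Phi (u : (Omega * T)%type) := (D1 u.1, resample i (D2 u.1) u.2).
have mW : measurable_fun [set: Omega] W by exact: measurable_fun_pair.
have mPhi : measurable_fun [set: (Omega * T)%type] Phi.
  apply: measurable_fun_pair; first exact: (measurableT_comp mD1 measurable_fst).
  have mDz : measurable_fun [set: (Omega * T)%type] (fun u => (D2 u.1, u.2)).
    apply: measurable_fun_pair; last exact: measurable_snd.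
    exact: (measurableT_comp mD2 measurable_fst).
  exact: (measurableT_comp (measurable_resample i) mDz).
pose W' : {mfun Omega >-> (n.-tuple T * n.-tuple T)%type} :=
  mfun_Sub (mem_set mW).
pose Phi' : {mfun (Omega * T)%type >-> (n.-tuple T * n.-tuple T)%type} :=
  mfun_Sub (mem_set mPhi).
have law A : measurable A ->
    pushforward P W' A = pushforward (P \x Q)%E Phi' A.
  apply: (@cylinder_measure_unique _ _ _ _
    (pushforward P W') (pushforward (P \x Q)%E Phi')); last first.
    by change (P setT < +oo)%E; rewrite probability_setT ltry.
  move=> {}A [E mE ->].
  rewrite [LHS](_ : _ = P [set w | forall j, j \in [set: 'I_n + 'I_n]%SET ->
      E j (coordinate j (D1 w, D2 w))]); last first.
    by congr (P _); apply/seteqP; split=> w /= h j //; apply: h; rewrite inE.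
  rewrite iid_cylinder_probability//.
  pose J := (~: [set inr i])%SET : {set 'I_n + 'I_n}.
  rewrite [RHS](_ : _ = (P \x Q)%E ([set w | forall j, j \in J ->
      E j (coordinate j (D1 w, D2 w))] `*` E (inr i))); last first.
    congr ((P \x Q)%E _); apply/seteqP; split=> -[w z] /=.
      move=> h; split; last first.
        by have := h (inr i); rewrite /= tnth_resample eqxx.
      move=> [] j; rewrite !inE => jJ; first exact: (h (inl j)).
      have := h (inr j); rewrite /= tnth_resample; case: eqP => // ji.
      by move: jJ; rewrite ji eqxx.
    move=> [h hi] [] j /=; first by apply: (h (inl j)); rewrite !inE.
    rewrite tnth_resample; case: eqP => [->//|ji].
    apply: (h (inr j)); rewrite !inE.
    by apply/eqP => -[].
  rewrite product_measure1E//=; last first.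
    rewrite (_ : [set w | _] = W @^-1`
      [set u | forall j, (if j \in J then E j else setT) (coordinate j u)]); last first.
      apply/seteqP; split=> w /= h j; first by case: ifPn => //; exact: h.
      by move=> jJ; have := h j; rewrite jJ.
    rewrite -[X in measurable X]setTI; apply: (mW) => //.
    apply: cylinder_measurable; exists (fun j => if j \in J then E j else setT) => //.
    by move=> j; case: ifP.
  rewrite iid_cylinder_probability//.
  rewrite (bigD1 (inr i))/= ?inE// muleC; congr (_ * _)%E.
  by apply: eq_bigl => j; rewrite !inE.
transitivity (\int[pushforward P W']_u H u)%E.
  by rewrite ge0_integral_pushforward//= preimage_setT.
rewrite (@eq_measure_integral _ _ _ _ (pushforward (P \x Q)%E Phi')); last first.
  by move=> A mA _; exact: law.
rewrite ge0_integral_pushforward//= preimage_setT.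
rewrite fubini_tonelli1//=.
exact: measurableT_comp.
Qed.

(** This is the conditional product rule for independent variables given D1.
    The factors are integrated out one at a time by resampling the last
    observation that is still present. *)
Lemma prod_moment_le (F : n.-tuple T -> T -> R) (kappa : R) :
  measurable_fun [set: (n.-tuple T * T)%type] (fun u => F u.1 u.2) ->
  (forall t z, 0 <= F t z) -> 0 <= kappa ->
  {ae P, forall w, (\int[Q]_z (F (D1 w) z)%:E <= kappa%:E)%E} ->
  (\int[P]_w (\prod_(i < n) F (D1 w) (tnth (D2 w) i))%:E <= (kappa ^+ n)%:E)%E.
Proof.
move=> mF F0 k0 aeF.
have mFi i : measurable_fun [set: (n.-tuple T * n.-tuple T)%type]
    (fun u => F u.1 (tnth u.2 i)).
  have m2 : measurable_fun [set: (n.-tuple T * n.-tuple T)%type]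
      (fun u => (u.1, tnth u.2 i)).
    apply: measurable_fun_pair; first exact: measurable_fst.
    exact: (measurableT_comp (measurable_tnth i) measurable_snd).
  exact: (measurableT_comp mF m2).
have mFint : measurable_fun [set: n.-tuple T] (fun t => \int[Q]_z (F t z)%:E)%E.
  apply: (@measurable_fun_fubini_tonelli_F _ _ _ _ _ Q
    (fun u : n.-tuple T * T => (F u.1 u.2)%:E)) => [|u].
    exact/measurable_EFinP.
  by rewrite lee_fin.
(* G m keeps the first m factors. *)
pose G m (u : (n.-tuple T * n.-tuple T)%type) : R :=
  \prod_(i < n) (if (i < m)%N then F u.1 (tnth u.2 i) else 1).
have G0 m u : 0 <= G m u by apply: prodr_ge0 => i _; case: ifP.
have mG m : measurable_fun [set: (n.-tuple T * n.-tuple T)%type] (G m).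
  apply: measurable_prod => i _; case: (i < m)%N; first exact: mFi.
  exact: measurable_cst.
suff step m : (m <= n)%N -> (\int[P]_w (G m (D1 w, D2 w))%:E <= (kappa ^+ m)%:E)%E.
  have := step n (leqnn n); congr (_ <= _)%E; apply: eq_integral => w _.
  by congr (_%:E); apply: eq_bigr => i _; rewrite ltn_ord.
elim: m => [_|m IHm mn].
  under eq_integral => w _ do rewrite /G big1 //=.
  by rewrite integral_cst//= mul1e probability_setT expr0.
pose im := Ordinal mn.
have GS u : G m.+1 u = F u.1 (tnth u.2 im) * G m u.
  rewrite /G (bigD1 im)//= ltnSn [in RHS](bigD1 im)//= ltnn mul1r.
  congr (_ * _); apply: eq_bigr => i iim.
  by rewrite ltnS leq_eqVlt (_ : (i == m :> nat) = (i == im))// (negbTE iim).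
have Gres w z : G m (D1 w, resample im (D2 w) z) = G m (D1 w, D2 w).
  apply: eq_bigr => i _ /=; case: ifP => // im'; rewrite tnth_resample.
  by case: eqP => // ii; move: im'; rewrite ii /= ltnn.
rewrite (resample_integral im (H := fun u => (G m.+1 u)%:E)); first last.
- by move=> u; rewrite lee_fin.
- exact/measurable_EFinP.
have inner w : (\int[Q]_z (G m.+1 (D1 w, resample im (D2 w) z))%:E =
    (G m (D1 w, D2 w))%:E * \int[Q]_z (F (D1 w) z)%:E)%E.
  rewrite -ge0_integralZl_EFin//.
  - by apply: eq_integral => z _; rewrite GS Gres /= tnth_resample eqxx mulrC EFinM.
  - by move=> z _; rewrite lee_fin.
  - by apply/measurable_EFinP; exact: (measurable_fun_pair2 (D1 w) mF).
under eq_integral do rewrite inner.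
have mGw : measurable_fun [set: Omega] (fun w => (G m (D1 w, D2 w))%:E).
  apply/measurable_EFinP; apply: (measurableT_comp (mG m)).
  exact: measurable_fun_pair.
apply: (@le_trans _ _ (\int[P]_w (kappa%:E * (G m (D1 w, D2 w))%:E))%E).
  apply: ae_ge0_le_integral => //.
  - by move=> w _; rewrite mule_ge0 ?lee_fin// integral_ge0// => z _; rewrite lee_fin.
  - apply: emeasurable_funM => //; exact: (measurableT_comp mFint mD1).
  - by move=> w _; rewrite mule_ge0 ?lee_fin.
  - exact: emeasurable_funM.
  - apply: filterS aeF => w h _; rewrite muleC lee_pmul//.
    + by rewrite integral_ge0// => z _; rewrite lee_fin.
    + by rewrite lee_fin.
rewrite ge0_integralZl_EFin//; last by move=> w _; rewrite lee_fin.
rewrite exprS EFinM lee_wpmul2l ?lee_fin//.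
exact: IHm (ltnW mn).
Qed.

(** A bound holding for almost every new observation given D1 also holds at
    the observations of D2: resampling computes the mean of the excess over
    B, which is therefore 0. *)
Lemma ae_sample2 (f : n.-tuple T -> T -> R) (B : R) :
  measurable_fun [set: (n.-tuple T * T)%type] (fun u => f u.1 u.2) ->
  {ae P, forall w, {ae Q, forall z, `|f (D1 w) z| <= B}} ->
  {ae P, forall w, forall i, `|f (D1 w) (tnth (D2 w) i)| <= B}.
Proof.
move=> mf aef; apply: filter_forall => i.
pose g t z : R := Num.max 0 (`|f t z| - B).
have mg : measurable_fun [set: (n.-tuple T * T)%type] (fun u => g u.1 u.2).
  apply: measurable_maxr; first exact: measurable_cst.
  by apply: measurable_funB; [exact: measurableT_comp|exact: measurable_cst].
have g0 t z : 0 <= g t z by rewrite le_max lexx.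
have mgi : measurable_fun [set: (n.-tuple T * n.-tuple T)%type]
    (fun u => (g u.1 (tnth u.2 i))%:E).
  apply/measurable_EFinP.
  have m2 : measurable_fun [set: (n.-tuple T * n.-tuple T)%type]
      (fun u => (u.1, tnth u.2 i)).
    apply: measurable_fun_pair; first exact: measurable_fst.
    exact: (measurableT_comp (measurable_tnth i) measurable_snd).
  exact: (measurableT_comp mg m2).
have mgint : measurable_fun [set: n.-tuple T] (fun t => \int[Q]_z (g t z)%:E)%E.
  apply: (@measurable_fun_fubini_tonelli_F _ _ _ _ _ Q
    (fun u : n.-tuple T * T => (g u.1 u.2)%:E)) => [|u].
    exact/measurable_EFinP.
  by rewrite lee_fin.
have inner0 : {ae P, forall w, (\int[Q]_z (g (D1 w) z)%:E = 0)%E}.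
  apply: filterS aef => w aew.
  have mgw : measurable_fun [set: T] (fun z => (g (D1 w) z)%:E).
    by apply/measurable_EFinP; exact: (measurable_fun_pair2 (D1 w) mg).
  have := (ae_eq_integral_abs Q measurableT mgw).2.
  under eq_integral do rewrite gee0_abs ?lee_fin//.
  apply; apply: filterS aew => z fz _; congr (_%:E).
  by apply/max_idPl; rewrite subr_le0.
have mgw : measurable_fun [set: Omega] (fun w => (g (D1 w) (tnth (D2 w) i))%:E).
  exact: (measurableT_comp mgi (measurable_fun_pair mD1 mD2)).
have : (\int[P]_w `|(g (D1 w) (tnth (D2 w) i))%:E| = 0)%E.
  under eq_integral do rewrite gee0_abs ?lee_fin//.
  rewrite (resample_integral i (H := fun u => (g u.1 (tnth u.2 i))%:E))//=;
    last by move=> u; rewrite lee_fin.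
  under eq_integral do under eq_integral do rewrite tnth_resample eqxx.
  rewrite (ae_eq_integral (cst 0%E))//=; first exact: integral0.
    exact: (measurableT_comp mgint mD1).
  by apply: filterS inner0 => w.
move=> I0; have aeg := (ae_eq_integral_abs P measurableT mgw).1 I0.
apply: filterS aeg => w /= /(_ I) /eqP.
by rewrite eqe => /eqP/max_idPl; rewrite subr_le0.
Qed.

End Resampling.

(** * Exponential moments of bounded variables *)

Lemma expR_le_quadratic (R : realType) (x : R) :
  `|x| <= 2^-1 -> expR x <= 1 + x + 2 * x ^+ 2.
Proof.
rewrite ler_norml => /andP[x1 x2].
have e1 : 1 - x <= expR (- x) by have := expR_ge1Dx (- x).
have x3 : 0 < 1 - x by lra.
rewrite -[x in expR x]opprK expRN.
apply: (@le_trans _ _ (1 - x)^-1); first by rewrite lef_pV2// posrE ?expR_gt0.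
rewrite -[leLHS]mul1r ler_pdivrMr//; nra.
Qed.

Section BoundedIntegrals.
Context {R : realType} {d : measure_display} {T : measurableType d}.
Variable Q : probability T R.

Lemma EFin_Rintegral (f : T -> R) : Q.-integrable setT (EFin \o f) ->
  ((\int[Q]_x f x)%:E = \int[Q]_x (f x)%:E)%E.
Proof. by move=> fi; rewrite /Rintegral fineK// integrable_fin_num. Qed.

Lemma Rintegral_probability_cst (r : R) : \int[Q]_x r = r.
Proof.
by rewrite Rintegral_cst// [X in fine X]probability_setT mulr1.
Qed.

Lemma Rintegral_eq0_ae (f : T -> R) : Q.-integrable setT (EFin \o f) ->
  {ae Q, forall x, 0 <= f x} -> \int[Q]_x f x = 0 -> {ae Q, forall x, f x = 0}.
Proof.
move=> fi f0 If0; have /integrableP[mf _] := fi.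
have I0 : (\int[Q]_x `|(EFin \o f) x| = 0)%E.
  rewrite (@ae_eq_integral _ _ _ _ _ (EFin \o f))//.
  - by rewrite -EFin_Rintegral// If0.
  - exact: measurableT_comp.
  - by apply: filterS f0 => x fx _; rewrite /= ger0_norm.
have := (ae_eq_integral_abs Q measurableT mf).1 I0.
by apply: filterS => x /(_ I) /eqP; rewrite /= eqe => /eqP.
Qed.

Lemma integrable_ae_bounded (f : T -> R) (M : R) :
  measurable_fun [set: T] f -> {ae Q, forall x, `|f x| <= M} ->
  Q.-integrable setT (EFin \o f).
Proof.
move=> mf aef; apply/integrableP; split; first exact/measurable_EFinP.
have M0 : 0 <= `|M| by [].
apply: (@le_lt_trans _ _ (`|M|%:E * Q setT)%E).
  apply: integral_le_bound => //; first exact/measurable_EFinP.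
  apply: filterS aef => x fM _ /=; rewrite lee_fin (le_trans fM)//.
  exact: ler_norm.
by rewrite probability_setT mule1 ltry.
Qed.

(** Bernstein's bound: only the second moment of f enters the exponent, and
    this is what makes the deviations of rare treatments small.  It suffices
    to integrate the inequality exp x <= 1 + x + 2 x^2 at x = eta f and to use
    1 + y <= exp y. *)
Lemma centered_exp_moment_le (f : T -> R) (M eta v : R) :
  measurable_fun [set: T] f -> {ae Q, forall x, `|f x| <= M} ->
  `|eta| * M <= 2^-1 -> \int[Q]_x (f x ^+ 2) <= v ->
  (\int[Q]_x (expR (eta * (f x - \int[Q]_y f y)))%:E <=
   (expR (2 * eta ^+ 2 * v))%:E)%E.
Proof.
move=> mf aef etaM fv.
have fi := integrable_ae_bounded mf aef.
have mf2 : measurable_fun [set: T] (fun x => f x ^+ 2).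
  exact: measurable_funX.
have f2i : Q.-integrable setT (EFin \o (fun x => f x ^+ 2)).
  apply: (@integrable_ae_bounded _ (M ^+ 2)) => //.
  apply: filterS aef => x fM; rewrite normrX lerXn2r// ?nnegrE//.
  exact: le_trans fM.
set m := \int[Q]_y f y.
pose g x := expR (- (eta * m)) * (1 + eta * f x + 2 * eta ^+ 2 * f x ^+ 2).
have ci r : Q.-integrable setT (EFin \o (fun=> r)).
  exact: finite_measure_integrable_cst.
have zi (h : T -> R) r : Q.-integrable setT (EFin \o h) ->
    Q.-integrable setT (EFin \o (fun x => r * h x)).
  by move=> hi; exact: (integrableZl measurableT r hi).
have di (h1 h2 : T -> R) : Q.-integrable setT (EFin \o h1) ->
    Q.-integrable setT (EFin \o h2) ->
    Q.-integrable setT (EFin \o (fun x => h1 x + h2 x)).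
  by move=> h1i h2i; exact: (integrableD measurableT h1i h2i).
have i1 := di _ _ (ci 1) (zi _ eta fi).
have i2 := di _ _ i1 (zi _ (2 * eta ^+ 2) f2i).
apply: (@le_trans _ _ (\int[Q]_x (g x)%:E)%E).
  apply: ae_ge0_le_integral => //.
  - apply/measurable_EFinP; apply: measurableT_comp => //.
    apply: measurable_funM => //; exact: measurable_funB.
  - by move=> x _; rewrite lee_fin mulr_ge0 ?expR_ge0//; nra.
  - by have /integrableP[] := zi _ (expR (- (eta * m))) i2.
  - apply: filterS aef => x fM _; rewrite lee_fin /g mulrBr expRD mulrC.
    rewrite ler_wpM2l ?expR_ge0//.
    have := @expR_le_quadratic _ (eta * f x); rewrite exprMn mulrA; apply.
    by rewrite normrM (le_trans _ etaM)// ler_wpM2l.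
rewrite -(EFin_Rintegral (zi _ (expR (- (eta * m))) i2)) lee_fin.
rewrite RintegralZl// (RintegralD measurableT i1 (zi _ _ f2i)).
rewrite (RintegralD measurableT (ci 1) (zi _ eta fi)) !RintegralZl//.
rewrite Rintegral_probability_cst -/m.
have -> : 2 * eta ^+ 2 * v = - (eta * m) + (eta * m + 2 * eta ^+ 2 * v).
  by rewrite addKr.
rewrite expRD ler_wpM2l ?expR_ge0//.
apply: le_trans (expR_ge1Dx _); rewrite addrA lerD2l ler_wpM2l//.
by rewrite mulr_ge0// sqr_ge0.
Qed.

End BoundedIntegrals.

(** * Conditional expectations *)

Section ConditionalExpectations.
Context {R : realType} {d d' : measure_display}.
Context {T : measurableType d} {T' : measurableType d'}.
Variables (Q : probability T R) (V : T -> T').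
Hypothesis mV : measurable_fun [set: T] V.

Lemma integrable_mul_bounded (g f : T -> R) (M : R) :
  measurable_fun [set: T] g -> (forall x, `|g x| <= M) ->
  Q.-integrable setT (EFin \o f) ->
  Q.-integrable setT (EFin \o (fun x => g x * f x)).
Proof.
move=> mg gM fi.
have bg : [bounded g x | x in [set: T]].
  exists M; split; first exact: num_real.
  by move=> N MN x _ /=; rewrite (le_trans (gM x))// ltW.
rewrite (_ : _ \o _ = ((EFin \o g) \* (EFin \o f))%E).
  exact: integrableMr.
by apply/funext => x /=; rewrite EFinM.
Qed.

(** D has conditional expectation 0 given V; the differences W - E(W | V) are
    the case of interest. *)
Definition conditionally_centered (D : T -> R) : Prop :=
  Q.-integrable setT (EFin \o D) /\
  forall E : set T', measurable E -> \int[Q]_(x in V @^-1` E) D x = 0.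

(** Write G = 1_A / 2 + G' / 2 with A = {1/2 <= G}, so that G' takes its values
    in [0, 1] again.  The indicator contributes nothing, hence the integral is
    halved; iterating on the binary digits of G avoids any approximation of G
    by simple functions. *)
Lemma centered_orthogonal_unit (D : T -> R) (j : nat) (G : T' -> R) :
  conditionally_centered D -> measurable_fun [set: T'] G ->
  (forall v, 0 <= G v <= 1) ->
  `|\int[Q]_x (G (V x) * D x)| <= 2^-1 ^+ j * \int[Q]_x `|D x|.
Proof.
move=> [Di D0]; elim: j G => [|j IHj] G mG G01.
  rewrite expr0 mul1r.
  have GDi : Q.-integrable setT (EFin \o (fun x => G (V x) * D x)).
    apply: (@integrable_mul_bounded (G \o V) D 1) => //.
    - exact: measurableT_comp.
    - by move=> x /=; have /andP[? ?] := G01 (V x); rewrite ger0_norm.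
  apply: (le_trans (le_normr_Rintegral measurableT GDi)).
  apply: le_Rintegral => //.
  - exact: integrable_norm.
  - exact: integrable_norm.
  - move=> x _; rewrite normrM ler_piMl//.
    by have /andP[? ?] := G01 (V x); rewrite ger0_norm.
pose A : set T' := [set v | 2^-1 <= G v].
have mA : measurable A.
  have mle := measurable_fun_ler (measurable_cst (2^-1 : R)) mG.
  by have := mle measurableT [set true] I; rewrite setTI.
pose G' v := 2 * G v - \1_A v.
have mG' : measurable_fun [set: T'] G'.
  apply: measurable_funB; first exact: measurable_funM.
  exact: measurable_indic.
have A01 v : `|\1_A v| <= 1 :> R.
  by rewrite indicE; case: (v \in A); rewrite ?normr1 ?normr0.
have G'01 v : 0 <= G' v <= 1.
  rewrite /G' indicE; have /andP[? ?] := G01 v.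
  have [h|h] := leP 2^-1 (G v).
    by rewrite (@mem_set _ A v h) /=; apply/andP; split; lra.
  rewrite (@memNset _ A v) /=; first by apply/andP; split; lra.
  by rewrite /A /= => h'; lra.
have G'i : Q.-integrable setT (EFin \o (fun x => G' (V x) * D x)).
  apply: (@integrable_mul_bounded (G' \o V) D 1) => //.
  - exact: measurableT_comp.
  - by move=> x /=; have /andP[? ?] := G'01 (V x); rewrite ger0_norm.
have Ai : Q.-integrable setT (EFin \o (fun x => \1_A (V x) * D x)).
  apply: (@integrable_mul_bounded (\1_A \o V) D 1) => //.
    by apply: measurableT_comp => //; exact: measurable_indic.
  by move=> x; exact: A01.
have A0 : \int[Q]_x (\1_A (V x) * D x) = 0.
  rewrite -(D0 A mA) [RHS]Rintegral_mkcond; apply: eq_Rintegral => x _.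
  by rewrite /= patchE indicE; case: ifPn => [/set_mem|/negP] h;
    [rewrite mem_set// mul1r | rewrite memNset ?mul0r// => h'; apply: h; exact: mem_set].
have -> : \int[Q]_x (G (V x) * D x) = 2^-1 * \int[Q]_x (G' (V x) * D x).
  rewrite -[RHS]addr0 -[X in _ + X](mulr0 2^-1) -A0 -!RintegralZl// -RintegralD//.
  - by apply: eq_Rintegral => x _; rewrite /G'; field.
  - exact: (integrableZl measurableT 2^-1 G'i).
  - exact: (integrableZl measurableT 2^-1 Ai).
rewrite normrM exprS -mulrA ger0_norm ?invr_ge0// ler_wpM2l ?invr_ge0//.
exact: IHj.
Qed.

(** A bounded G is an affine image of a function with values in [0, 1], to
    which the preceding bound applies for every j. *)
Lemma centered_orthogonal (D : T -> R) (G : T' -> R) (M : R) :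
  conditionally_centered D -> measurable_fun [set: T'] G ->
  {ae Q, forall x, `|G (V x)| <= M} -> measurable_fun [set: T] D ->
  \int[Q]_x (G (V x) * D x) = 0.
Proof.
move=> cD mG aeG mD; have [Di D0] := cD.
pose N := `|M| + 1.
have N0 : 0 < N by rewrite ltr_wpDl.
pose H v : R := Num.min 1 (Num.max 0 (G v / (2 * N) + 2^-1)).
have mH : measurable_fun [set: T'] H.
  apply: measurable_minr; first exact: measurable_cst.
  apply: measurable_maxr; first exact: measurable_cst.
  apply: measurable_funD; last exact: measurable_cst.
  by apply: measurable_funM => //; exact: measurable_cst.
have H01 v : 0 <= H v <= 1.
  by rewrite /H le_min ler01 le_max lexx ge_min lexx.
have Hi : Q.-integrable setT (EFin \o (fun x => H (V x) * D x)).
  apply: (@integrable_mul_bounded (H \o V) D 1) => //.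
    exact: measurableT_comp.
  by move=> x /=; have /andP[? ?] := H01 (V x); rewrite ger0_norm.
have H0 : \int[Q]_x (H (V x) * D x) = 0.
  apply/eqP; rewrite -normr_le0.
  pose C := \int[Q]_x `|D x|.
  have C0 : 0 <= C by apply: Rintegral_ge0.
  have hC j : `|\int[Q]_x (H (V x) * D x)| <= 2^-1 ^+ j * C.
    exact: centered_orthogonal_unit.
  apply/ler_addgt0Pr => e e0; rewrite add0r.
  have [j Cj] : exists j : nat, C / e <= j%:R.
    by exists (Num.bound (C / e)); rewrite ltW// archi_boundP// divr_ge0// ltW.
  apply: le_trans (hC j) _; rewrite exprVn ler_pdivrMl ?exprn_gt0//.
  rewrite -ler_pdivrMr// (le_trans Cj)// -natrX ler_nat ltnW//.
  exact: ltn_expl.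
have -> : \int[Q]_x (G (V x) * D x) =
    \int[Q]_x (2 * N * (H (V x) * D x) - N * D x).
  congr fine; apply: ae_eq_integral => //.
  - apply/measurable_EFinP; apply: measurable_funM => //.
    exact: measurableT_comp.
  - apply/measurable_EFinP; apply: measurable_funB; last exact: measurable_funM.
    apply: measurable_funM => //; apply: measurable_funM => //.
    exact: measurableT_comp.
  - apply: filterS aeG => x Gx _; congr (_%:E).
    have GN : `|G (V x)| <= N.
      by rewrite (le_trans Gx)// (le_trans (ler_norm _))// lerDl.
    move: GN; rewrite ler_norml => /andP[g1 g2].
    have h1 : 0 <= G (V x) / (2 * N) + 2^-1.
      rewrite (_ : _ + _ = (G (V x) + N) / (2 * N)); last by field; lra.
      by rewrite divr_ge0//; lra.
    have h2 : G (V x) / (2 * N) + 2^-1 <= 1.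
      rewrite (_ : _ + _ = (G (V x) + N) / (2 * N)); last by field; lra.
      by rewrite ler_pdivrMr; lra.
    rewrite /H (max_idPr h1) (min_idPr h2); field; lra.
rewrite RintegralB// ?RintegralZl//.
- have I0 : \int[Q]_x D x = 0 := D0 setT measurableT.
  by rewrite H0 I0 !mulr0 subrr.
- exact: (integrableZl measurableT (2 * N) Hi).
- exact: (integrableZl measurableT N Di).
Qed.

Lemma cond_expectation_centered (W : T -> R) (m : T' -> R) :
  Q.-integrable setT (EFin \o W) -> is_cond_expectation Q V W m ->
  conditionally_centered (fun x => W x - m (V x)).
Proof.
move=> Wi [mm mi Em]; split.
  exact: (integrableB measurableT Wi mi).
move=> E mE; have mVE : measurable (V @^-1` E).
  by rewrite -[X in measurable X]setTI; exact: mV.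
rewrite RintegralB//; last 2 first.
- exact: (integrableS measurableT).
- exact: (integrableS measurableT).
by rewrite /Rintegral Em// subrr.
Qed.

(** Testing W - m(V) against the sign of m on the event where m leaves
    [-B, B] gives an integrand of constant sign and of integral 0. *)
Lemma cond_expectation_bounded (W : T -> R) (m : T' -> R) (B : R) :
  measurable_fun [set: T] W -> {ae Q, forall x, `|W x| <= B} ->
  is_cond_expectation Q V W m ->
  {ae Q, forall x, `|m (V x)| <= B}.
Proof.
move=> mW aeW condW; have [mm mi _] := condW.
have Wi := integrable_ae_bounded mW aeW.
have cD := cond_expectation_centered Wi condW.
have mD : measurable_fun [set: T] (fun x => W x - m (V x)).
  by apply: measurable_funB => //; exact: measurableT_comp.
(* G is the sign of m outside [-B, B], so that G(V) (W - m(V)) <= 0. *)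
pose G (v : T') : R := (B < m v)%R%:R - (m v < - B)%R%:R.
have mbool (b : T' -> bool) : measurable_fun [set: T'] b ->
    measurable_fun [set: T'] (fun v => (b v)%:R : R).
  move=> mb; rewrite (_ : (fun _ => _) = (fun v => if b v then 1 else 0)).
    by apply: measurable_fun_ifT => //; exact: measurable_cst.
  by apply/funext => v; case: (b v).
have mG : measurable_fun [set: T'] G.
  apply: measurable_funB; apply: mbool; apply: measurable_fun_ltr => //;
    exact: measurable_cst.
have G1 v : `|G v| <= 1.
  rewrite /G; case: (B < m v); case: (m v < - B);
    by rewrite /= ?subrr ?subr0 ?sub0r ?normrN ?normr0 ?normr1.
have GD0 : \int[Q]_x (G (V x) * (W x - m (V x))) = 0.
  apply: (centered_orthogonal (M := 1) cD mG _ mD); apply: nearW => x.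
  exact: G1.
have GDi : Q.-integrable setT (EFin \o (fun x => G (V x) * (W x - m (V x)))).
  apply: (@integrable_mul_bounded (G \o V) _ 1) => //; last by case: cD.
    exact: measurableT_comp.
  by move=> x; exact: G1.
have NGDi : Q.-integrable setT
    (EFin \o (fun x => -1 * (G (V x) * (W x - m (V x))))).
  exact: (integrableZl measurableT (-1) GDi).
have GDle : {ae Q, forall x, G (V x) * (W x - m (V x)) <= 0}.
  apply: filterS aeW => x; rewrite ler_norml /G => /andP[w1 w2].
  by case: ltP => h1; case: ltP => h2; rewrite /= ?subrr ?subr0 ?sub0r; nra.
have NGDge : {ae Q, forall x, 0 <= -1 * (G (V x) * (W x - m (V x)))}.
  by apply: filterS GDle => x; rewrite mulN1r oppr_ge0.
have NGD0 : \int[Q]_x (-1 * (G (V x) * (W x - m (V x)))) = 0.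
  by rewrite RintegralZl// GD0 mulr0.
have := Rintegral_eq0_ae NGDi NGDge NGD0.
apply: filterS2 aeW => x; rewrite ler_norml /G => /andP[w1 w2].
rewrite ler_norml => /eqP.
by case: ltP => h1; case: ltP => h2; rewrite /= ?subrr ?subr0 ?sub0r => /eqP; nra.
Qed.

End ConditionalExpectations.

(** * Quadratic risks and sparse errors *)

Section QuadraticRisk.
Context {R : realType} {k : nat}.
Implicit Types (q th b psi : 'I_k -> R) (s : nat).

Definition quadratic_risk q th b : R :=
  \sum_(a < k) (q a * b a ^+ 2 - 2 * th a * b a).

(** Both sides differ by the difference of the two risks: the risk is
    quadratic, with gradient -2 (th - q psi) at psi. *)
Lemma basic_inequality q th b psi :
  quadratic_risk q th b <= quadratic_risk q th psi ->
  \sum_(a < k) q a * (b a - psi a) ^+ 2 <=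
  2 * \sum_(a < k) (th a - q a * psi a) * (b a - psi a).
Proof.
rewrite -subr_le0 -sumrB => h; rewrite -subr_le0 mulr_sumr -sumrB.
apply: le_trans h; rewrite le_eqVlt; apply/orP; left.
by apply/eqP/eq_bigr => a _; ring.
Qed.

Lemma sqr_sum_le_card (S : {set 'I_k}) (x : 'I_k -> R) :
  (\sum_(a in S) x a) ^+ 2 <= #|S|%:R * \sum_(a in S) x a ^+ 2.
Proof.
have [->|S0] := eqVneq S finset.set0.
  by rewrite !big_set0 expr0n mulr0.
have c0 : 0 < #|S|%:R :> R by rewrite ltr0n card_gt0.
set t := \sum_(a in S) x a.
have : 0 <= \sum_(a in S) (#|S|%:R * x a - t) ^+ 2.
  by apply: sumr_ge0 => a _; exact: sqr_ge0.
rewrite (_ : \sum_(a in S) _ = #|S|%:R *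
    (#|S|%:R * (\sum_(a in S) x a ^+ 2) - t ^+ 2)).
  by rewrite pmulr_rge0// subr_ge0.
rewrite (eq_bigr (fun a => #|S|%:R ^+ 2 * x a ^+ 2
    - (2 * #|S|%:R * t) * x a + t ^+ 2)); last by move=> a _; ring.
rewrite big_split/= sumrB -!mulr_sumr sumr_const -/t -mulr_natl.
by ring.
Qed.

Lemma sum_support (v : 'I_k -> R) (S : {set 'I_k}) (f : R -> R) :
  f 0 = 0 -> (forall a, a \notin S -> v a = 0) ->
  \sum_(a < k) f (v a) = \sum_(a in S) f (v a).
Proof.
move=> f0 vS; rewrite [RHS]big_mkcond; apply: eq_bigr => a _.
by case: ifPn => // /vS ->.
Qed.

(** Outside the support of psi the error is b itself, and the constraint
    bounds the mass of b there by what b loses on the support: the error has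
    at least half of its l1 norm on the support of psi. *)
Lemma lasso_error_cone b psi :
  l1norm b <= l1norm psi ->
  l1norm (fun a => b a - psi a) ^+ 2 <=
  4 * (l0norm psi)%:R * \sum_(a < k) (b a - psi a) ^+ 2.
Proof.
move=> bpsi; pose S := [set a | psi a != 0]%SET.
have psiS a : a \notin S -> psi a = 0 by rewrite inE negbK => /eqP.
have h1 : l1norm (fun a => b a - psi a) <= 2 * \sum_(a in S) `|b a - psi a|.
  move: bpsi; rewrite /l1norm (@sum_support psi S)//; last exact: normr0.
  rewrite (bigID (mem S))/= [X in _ -> X <= _](bigID (mem S))/=.
  have -> : \sum_(a | a \notin S) `|b a - psi a| = \sum_(a | a \notin S) `|b a|.
    by apply: eq_bigr => a /psiS ->; rewrite subr0.
  have : \sum_(a in S) `|psi a| <=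
      \sum_(a in S) `|b a| + \sum_(a in S) `|b a - psi a|.
    rewrite -big_split/=; apply: ler_sum => a _.
    by rewrite -[X in `|X| <= _](subKr (b a)) ler_normB.
  lra.
apply: le_trans (_ : 4 * (\sum_(a in S) `|b a - psi a|) ^+ 2 <= _).
  rewrite (_ : 4 = 2 ^+ 2 :> R) -?exprMn ?ler_sqr ?nnegrE//; last by ring.
  - by rewrite sumr_ge0.
  - by rewrite mulr_ge0// sumr_ge0.
rewrite -mulrA ler_wpM2l//; apply: le_trans (sqr_sum_le_card _ _) _.
rewrite ler_wpM2l// big_mkcond/= ler_sum// => a _.
by case: ifP => _; rewrite ?sqr_ge0// real_normK ?num_real.
Qed.

Lemma l0norm_sub b psi :
  (l0norm (fun a => (b a - psi a)%R) <= l0norm b + l0norm psi)%N.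
Proof.
apply: leq_trans (leq_card_setU _ _).
apply/subset_leq_card/fintype.subsetP => a; rewrite !inE; apply: contraR.
by rewrite negb_or !negbK => /andP[/eqP-> /eqP->]; rewrite subrr.
Qed.

Lemma l0norm_error_cone s b psi :
  (l0norm b <= s)%N -> (l0norm psi <= s)%N ->
  l1norm (fun a => b a - psi a) ^+ 2 <=
  4 * s%:R * \sum_(a < k) (b a - psi a) ^+ 2.
Proof.
move=> bs ps; pose S := [set a | b a - psi a != 0]%SET.
have S2 : (#|S| <= 2 * s)%N.
  by rewrite mul2n -addnn (leq_trans (l0norm_sub b psi))// leq_add.
have vS a : a \notin S -> b a - psi a = 0 by rewrite inE negbK => /eqP.
rewrite /l1norm (@sum_support (fun a => b a - psi a) S Num.norm)//; last exact: normr0.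
apply: le_trans (sqr_sum_le_card _ _) _.
apply: ler_pM => //.
- by rewrite sumr_ge0// => a _; exact: sqr_ge0.
- rewrite -natrM ler_nat (leq_trans S2)// leq_mul2r; apply/orP; right; by [].
rewrite big_mkcond/= ler_sum// => a _.
by case: ifP => _; rewrite ?sqr_ge0// real_normK ?num_real.
Qed.

(** The basic inequality bounds kappa |error|_2^2 by 2 G |error|_1, and the
    cone condition makes the latter at most a multiple of
    G sqrt s |error|_2. *)
Lemma sparse_error_bound s q th b psi (kappa G : R) :
  0 < kappa -> (forall a, kappa <= q a) ->
  (forall a, `|th a - q a * psi a| <= G) ->
  quadratic_risk q th b <= quadratic_risk q th psi ->
  l1norm (fun a => b a - psi a) ^+ 2 <=
    4 * s%:R * \sum_(a < k) (b a - psi a) ^+ 2 ->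
  kappa ^+ 2 * \sum_(a < k) (b a - psi a) ^+ 2 <= 16 * s%:R * G ^+ 2.
Proof.
move=> kappa0 kq gG /basic_inequality bi cone.
set X := \sum_(a < k) (b a - psi a) ^+ 2 in cone *.
set l := l1norm _ in cone.
have X0 : 0 <= X by apply: sumr_ge0 => a _; exact: sqr_ge0.
have l0 : 0 <= l by apply: sumr_ge0.
have h1 : kappa * X <= 2 * (G * l).
  apply: (@le_trans _ _ (\sum_(a < k) q a * (b a - psi a) ^+ 2)).
    by rewrite mulr_sumr ler_sum// => a _; rewrite ler_wpM2r// sqr_ge0.
  apply: le_trans bi _; rewrite ler_wpM2l// mulr_sumr ler_sum// => a _.
  by rewrite (le_trans (ler_norm _))// normrM ler_wpM2r.
have [X00|X1] := eqVneq X 0.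
  by rewrite X00 mulr0 mulr_ge0 ?sqr_ge0 ?mulr_ge0.
have {}X1 : 0 < X by rewrite lt_neqAle eq_sym X1.
rewrite -(ler_pM2r X1).
apply: le_trans (_ : (2 * (G * l)) ^+ 2 <= _).
  rewrite (_ : kappa ^+ 2 * X * X = (kappa * X) ^+ 2); last by ring.
  have kX0 : 0 <= kappa * X by rewrite mulr_ge0// ltW.
  by rewrite lerXn2r// nnegrE// (le_trans kX0).
rewrite (_ : (2 * _) ^+ 2 = 4 * G ^+ 2 * l ^+ 2); last by ring.
apply: (@le_trans _ _ (4 * G ^+ 2 * (4 * s%:R * X))).
  by rewrite ler_wpM2l// mulr_ge0// sqr_ge0.
by rewrite le_eqVlt; apply/orP; left; apply/eqP; ring.
Qed.

(** Moving a nonzero coordinate of b does not enlarge its support, so that b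
    minimises the risk separately in each of these coordinates. *)
Lemma subset_argmin_coordinate s q th b a :
  subset_argmin s (quadratic_risk q th) b -> 0 < q a -> b a != 0 ->
  b a = th a / q a.
Proof.
move=> [/= bs bmin] qa ba.
pose b' i := if i == a then th a / q a else b i.
have /bmin : (l0norm b' <= s)%N.
  apply: leq_trans bs; apply/subset_leq_card/fintype.subsetP => i; rewrite !inE /b'.
  by case: (eqVneq i a) => [-> _|].  
rewrite -subr_ge0 /quadratic_risk -sumrB (bigD1 a)//= big1 => [|i ia]; last first.
  by rewrite /b' (negbTE ia) subrr.
rewrite addr0 /b' eqxx => h; apply/eqP; rewrite -subr_eq0 -sqrf_eq0.
rewrite eq_le sqr_ge0 andbT -(pmulr_rle0 _ qa).
rewrite (_ : q a * _ = - (q a * (th a / q a) ^+ 2 - 2 * th a * (th a / q a) -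
  (q a * b a ^+ 2 - 2 * th a * b a))); first by rewrite oppr_le0.
by field; rewrite gt_eqF.
Qed.

(** Completing the squares, the best risk with support in S is
    - sum_(a in S) th_a^2 / q_a, so a minimiser is found by maximising over
    the finitely many supports of at most s elements. *)
Lemma subset_argmin_exists s q th :
  (forall a, 0 < q a) -> subset_argmin s (quadratic_risk q th) !=set0.
Proof.
move=> q0; pose gain (S : {set 'I_k}) := \sum_(a in S) th a ^+ 2 / q a.
have P0 : (#|(finset.set0 : {set 'I_k})| <= s)%N by rewrite cards0.
have [S Ss Smax] := @arg_maxP _ _ _ finset.set0
  (fun S : {set 'I_k} => (#|S| <= s)%N) gain P0.
have lb b (U : {set 'I_k}) : (forall a, a \notin U -> b a = 0) ->
    - gain U <= quadratic_risk q th b.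
  move=> bU; rewrite /quadratic_risk (bigID (mem U))/= [X in _ + X]big1; last first.
    by move=> a /bU ->; ring.
  rewrite addr0 -sumrN; apply: ler_sum => a _; rewrite -subr_ge0.
  rewrite (_ : _ - _ = q a * (b a - th a / q a) ^+ 2).
    by rewrite mulr_ge0 ?sqr_ge0// ltW.
  by field; rewrite gt_eqF.
exists (fun a => if a \in S then th a / q a else 0); split => /=.
  apply: leq_trans Ss; apply/subset_leq_card/fintype.subsetP => a; rewrite inE.
  by case: ifP; rewrite ?eqxx.
move=> b bs; apply: le_trans (lb b [set a | b a != 0]%SET _); last first.
  by move=> a; rewrite inE negbK => /eqP.
apply: (@le_trans _ _ (- gain S)); last by rewrite lerN2; exact: Smax.
rewrite /quadratic_risk (bigID (mem S))/= [X in _ + X]big1; last first.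
  by move=> a /negbTE ->; ring.
rewrite addr0 -sumrN ler_sum// => a aS; rewrite aS.
rewrite le_eqVlt; apply/orP; left; apply/eqP.
by field; rewrite gt_eqF.
Qed.

End QuadraticRisk.

(** * Moments of the score of one treatment *)

Lemma measurable_inv (R : realType) : measurable_fun [set: R] (@GRing.inv R).
Proof.
rewrite -(setvU [set (0 : R)]); apply/measurable_funU => //.
  exact: measurableC.
split; last exact: measurable_fun_set1.
apply: open_continuous_measurable_fun; last first.
  by move=> x /set_mem /= x0; apply: inv_continuous; exact/eqP.
rewrite openC; exact: closed_eq.
Qed.

Section ObservationMeasurability.
Context {R : realType} {d k n : nat}.
Local Notation obs := (observation R d k).

Lemma measurable_cov : measurable_fun [set: obs] (@cov R d k).
Proof. exact: (measurableT_comp measurable_fst measurable_fst). Qed.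

Lemma measurable_outcome : measurable_fun [set: obs] (@outcome R d k).
Proof. exact: measurable_snd. Qed.

Lemma measurable_trt : measurable_fun [set: obs] (@trt R d k).
Proof. exact: (measurableT_comp measurable_snd measurable_fst). Qed.

Definition treated (a : 'I_k.+1) (z : obs) : R := (trt z == a)%:R.

Lemma measurable_treatment_indicator a :
  measurable_fun [set: 'I_k.+1] (fun b => (b == a)%:R : R).
Proof. by move=> _ Y _. Qed.

Lemma measurable_treated a : measurable_fun [set: obs] (treated a).
Proof.
exact: (measurableT_comp (measurable_treatment_indicator a) measurable_trt).
Qed.

Lemma measurable_treatment_freq a :
  measurable_fun [set: n.-tuple obs] (fun u => treatment_freq u a).
Proof.
apply: measurable_funM; first exact: measurable_cst.
apply: measurable_sum => i.
exact: (measurableT_comp (measurable_treated a) (measurable_tnth i)).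
Qed.

Lemma measurable_estimator_eval (f : estimator R d k n) a :
  measurable_estimator f ->
  measurable_fun [set: (n.-tuple obs * obs)%type]
    (fun u : (n.-tuple obs * obs)%type => f a u.1 (cov u.2)).
Proof.
move=> mf; have mc : measurable_fun [set: (n.-tuple obs * obs)%type]
    (fun u : (n.-tuple obs * obs)%type => (u.1, cov u.2)).
  apply: measurable_fun_pair; first exact: measurable_fst.
  exact: (measurableT_comp measurable_cov measurable_snd).
exact: (measurableT_comp (mf a) mc).
Qed.

End ObservationMeasurability.

Section ScoreMoments.
Context {R : realType} {d k : nat}.
Local Notation obs := (observation R d k).
Variables (Q : probability obs R) (mu pi : 'I_k.+1 -> covariate R d -> R).
Hypothesis condmu : is_cond_expectation Q (fun z => (cov z, trt z))
  (@outcome R d k) (fun u => mu u.2 u.1).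
Hypothesis condpi : forall a, is_cond_expectation Q (@cov R d k)
  (fun z => (trt z == a)%:R) (pi a).
Hypothesis pi_gt0 : forall a, {ae Q, forall z, 0 < pi a (cov z)}.
Variable B : R.
Hypothesis outcome_bounded : {ae Q, forall z, `|outcome z| <= B}.

Lemma treated_le1 a (z : obs) : `|treated a z : R| <= 1.
Proof. by rewrite /treated; case: eqP => _; rewrite /= ?normr1 ?normr0. Qed.

Lemma integrable_treated a : Q.-integrable setT (EFin \o (treated a : obs -> R)).
Proof.
apply: (@integrable_ae_bounded _ _ _ _ _ 1); first exact: measurable_treated.
by apply: nearW => z; exact: treated_le1.
Qed.

Lemma Rintegral_treated a : \int[Q]_z (treated a z : R) = treatment_prob Q a.
Proof.
rewrite /Rintegral /treatment_prob; congr fine.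
have mA : measurable [set z : obs | trt z = a].
  rewrite -[X in measurable X]setTI.
  exact: (measurable_trt measurableT (Y := [set a])).
rewrite -[in RHS](setIT [set z | trt z = a]) -integral_indic//.
apply: eq_integral => z _; rewrite /treated indicE; congr (_%:E).
by case: eqP => h; [rewrite mem_set|rewrite memNset].
Qed.

Lemma measurable_pair_cov_trt :
  measurable_fun [set: obs] (fun z : obs => (cov z, trt z)).
Proof. exact: measurable_fun_pair measurable_cov measurable_trt. Qed.

Lemma measurable_regression a : measurable_fun [set: covariate R d] (mu a).
Proof.
have [mmu _ _] := condmu.
by have := measurable_fun_pair1 a mmu.
Qed.

Lemma measurable_propensity a : measurable_fun [set: covariate R d] (pi a).
Proof. by have [] := condpi a. Qed.

Lemma treated_centered a :
  conditionally_centered Q (@cov R d k) (fun z => treated a z - pi a (cov z)).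
Proof.
exact: (cond_expectation_centered measurable_cov (integrable_treated a)
  (condpi a)).
Qed.

Lemma propensity_le1 a : {ae Q, forall z, `|pi a (cov z)| <= 1}.
Proof.
apply: (cond_expectation_bounded measurable_cov _ _ (condpi a)).
  exact: measurable_treated.
by apply: nearW => z; exact: treated_le1.
Qed.

Lemma treated_orthogonal a (G : covariate R d -> R) (M : R) :
  measurable_fun [set: covariate R d] G ->
  {ae Q, forall z, `|G (cov z)| <= M} ->
  \int[Q]_z (G (cov z) * (treated a z - pi a (cov z))) = 0.
Proof.
move=> mG GM; apply: (centered_orthogonal measurable_cov (treated_centered a) mG GM).
apply: measurable_funB; first exact: measurable_treated.
exact: (measurableT_comp (measurable_propensity a) measurable_cov).
Qed.

(** Conditioning on the covariates and the treatment bounds mu_A(X) only,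
    hence mu_a(X) on the event A = a.  If mu_a(X) left [-B, B] on an event E,
    then E and A = a would be disjoint and pi_a(X) would have integral 0 on E;
    as pi_a > 0, the event E is negligible. *)
Lemma regression_bounded a : {ae Q, forall z, `|mu a (cov z)| <= B}.
Proof.
have muB := cond_expectation_bounded measurable_pair_cov_trt measurable_outcome
  outcome_bounded condmu.
pose G x : R := (B < `|mu a x|)%R%:R.
have mG : measurable_fun [set: covariate R d] G.
  rewrite (_ : G = (fun x => if B < `|mu a x| then 1 else 0)); last first.
    by apply/funext => x; rewrite /G; case: (_ < _).
  apply: measurable_fun_ifT => //.
  apply: measurable_fun_ltr; first exact: measurable_cst.
  apply: measurableT_comp => //; exact: measurable_regression.
have G01 x : 0 <= G x <= 1 by rewrite /G; case: (_ < _); rewrite /= lexx ler01.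
have G1 : {ae Q, forall z, `|G (cov z)| <= 1}.
  by apply: nearW => z; have /andP[? ?] := G01 (cov z); rewrite ger0_norm.
have Gi : Q.-integrable setT (EFin \o (fun z => G (cov z) * pi a (cov z))).
  apply: (@integrable_ae_bounded _ _ _ _ _ 1).
    apply: measurable_funM; apply: (measurableT_comp _ measurable_cov) => //.
    exact: measurable_propensity.
  apply: filterS2 G1 (propensity_le1 a) => z g1 p1.
  by rewrite normrM mulr_ile1.
have Gpi0 : \int[Q]_z (G (cov z) * pi a (cov z)) = 0.
  have := treated_orthogonal a mG G1.
  have -> : \int[Q]_z (G (cov z) * (treated a z - pi a (cov z))) =
     \int[Q]_z (- 1 * (G (cov z) * pi a (cov z))).
    congr fine; apply: ae_eq_integral => //.
    - apply/measurable_EFinP; apply: measurable_funM.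
        exact: (measurableT_comp mG measurable_cov).
      apply: measurable_funB; first exact: measurable_treated.
      exact: (measurableT_comp (measurable_propensity a) measurable_cov).
    - by have /integrableP[] := integrableZl measurableT (-1) Gi.
    - apply: filterS muB => z muz _; congr (_%:E).
      rewrite /treated; case: eqP => [za|_]; last by rewrite sub0r mulN1r mulrN.
      by rewrite /G ltNge -za muz !mul0r mulr0.
  by rewrite RintegralZl// mulN1r => /eqP; rewrite oppr_eq0 => /eqP.
have Gpi_ge0 : {ae Q, forall z, 0 <= G (cov z) * pi a (cov z)}.
  apply: filterS (pi_gt0 a) => z p0.
  by have /andP[? ?] := G01 (cov z); rewrite mulr_ge0// ltW.
have := Rintegral_eq0_ae Gi Gpi_ge0 Gpi0.
apply: filterS2 (pi_gt0 a) => z p0 /eqP; rewrite mulf_eq0 (gt_eqF p0) orbF.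
by rewrite /G leNgt; case: (_ < _); rewrite //= oner_eq0.
Qed.

Variables (psi0 : R) (psi : 'I_k.+1 -> R).
Hypothesis effect_mean : forall a,
  ('E_Q[mu a \o cov] = (psi0 + psi a)%R%:E)%E.
Hypothesis psi0_bounded : `|psi0| <= B.

Lemma integrable_regression a : Q.-integrable setT (EFin \o (mu a \o cov)).
Proof.
apply: (@integrable_ae_bounded _ _ _ _ _ B); last exact: regression_bounded.
exact: (measurableT_comp (measurable_regression a) measurable_cov).
Qed.

Lemma Rintegral_regression a : \int[Q]_z mu a (cov z) = psi0 + psi a.
Proof. by rewrite /Rintegral; move: (effect_mean a); rewrite unlock => ->. Qed.

Lemma effect_bounded a : `|psi a| <= 2 * B.
Proof.
have -> : psi a = \int[Q]_z mu a (cov z) - psi0.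
  by rewrite Rintegral_regression addrAC subrr add0r.
rewrite (le_trans (ler_normB _ _))// mulrDl mul1r lerD//.
apply: (le_trans (le_normr_Rintegral measurableT (integrable_regression a))).
have Bi : Q.-integrable setT (EFin \o (fun=> B)).
  exact: finite_measure_integrable_cst.
rewrite -[leRHS](Rintegral_probability_cst Q).
rewrite -lee_fin !EFin_Rintegral//; last exact: integrable_norm (integrable_regression a).
apply: ae_ge0_le_integral => //.
- by have /integrableP[] := integrable_norm (integrable_regression a).
- by move=> z _; rewrite lee_fin (le_trans _ psi0_bounded).
- by apply: filterS (regression_bounded a) => z h _; rewrite lee_fin.
Qed.

Section SingleScore.
Variables (a : 'I_k.+1) (wh : R) (mh ph : covariate R d -> R).
Hypotheses (wh_ge0 : 0 <= wh) (wh_le1 : wh <= 1).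
Hypotheses (mmh : measurable_fun [set: covariate R d] mh)
  (mph : measurable_fun [set: covariate R d] ph).
Hypothesis weight_bounded : {ae Q, forall z, `|wh / ph (cov z)| <= B}.
Hypothesis mh_bounded : {ae Q, forall z, `|mh (cov z)| <= B}.

(** The contribution of one observation to half the negative gradient of the
    empirical risk at psi, for the treatment a, with the weight wh, the
    regression mh and the propensity ph in the place of the estimates. *)
Definition score (z : obs) : R :=
  (treated a z / ph (cov z) * (outcome z - mh (cov z)) + mh (cov z) - psi0)
    * wh - treated a z * psi a.

Lemma measurable_score : measurable_fun [set: obs] score.
Proof.
have mmhc : measurable_fun [set: obs] (fun z => mh (cov z)).
  exact: (measurableT_comp mmh measurable_cov).
apply: measurable_funB; last first.
  by apply: measurable_funM; [exact: measurable_treated|exact: measurable_cst].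
apply: measurable_funM; last exact: measurable_cst.
apply: measurable_funB; last exact: measurable_cst.
apply: measurable_funD => //.
apply: measurable_funM; last first.
  by apply: measurable_funB => //; exact: measurable_outcome.
apply: measurable_funM; first exact: measurable_treated.
have mphc : measurable_fun [set: obs] (fun z => ph (cov z)).
  exact: (measurableT_comp mph measurable_cov).
exact: (measurableT_comp (@measurable_inv R) mphc).
Qed.

Lemma scoreE z : score z =
  treated a z * (wh / ph (cov z) * (outcome z - mh (cov z)) - psi a)
  + wh * (mh (cov z) - psi0).
Proof. rewrite /score; ring. Qed.

Lemma ae_score_parts : {ae Q, forall z,
  `|wh / ph (cov z) * (outcome z - mh (cov z)) - psi a| <= 2 * B ^+ 2 + 2 * B
  /\ `|mh (cov z) - psi0| <= 2 * B}.
Proof.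
have psiB := effect_bounded a.
apply: filterS3 weight_bounded mh_bounded outcome_bounded => z hB mB yB.
have d2 (x y : R) : `|x| <= B -> `|y| <= B -> `|x - y| <= 2 * B.
  by move=> ? ?; rewrite (le_trans (ler_normB _ _))// mulrDl mul1r lerD.
split; last exact: d2.
rewrite (le_trans (ler_normB _ _))// lerD// normrM.
rewrite (_ : 2 * B ^+ 2 = B * (2 * B)); last by ring.
by apply: ler_pM => //; exact: d2.
Qed.

Lemma ae_score_bounded : {ae Q, forall z, `|score z| <= 2 * B ^+ 2 + 4 * B}.
Proof.
apply: filterS ae_score_parts => z [h1 h2]; rewrite scoreE.
have B0 : 0 <= B by exact: le_trans psi0_bounded.
rewrite (le_trans (ler_normD _ _))//.
rewrite (_ : _ + 4 * B = (2 * B ^+ 2 + 2 * B) + 2 * B); last by ring.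
apply: lerD; rewrite normrM.
  by rewrite (le_trans _ h1)// ler_piMl// treated_le1.
by rewrite (le_trans _ h2)// ler_piMl// ger0_norm.
Qed.

(** The score is treated * p + wh * q with p and q bounded: its second moment
    is of the order of P(A = a) + wh, hence of 1 / k when wh is, and not
    merely bounded. *)
Lemma score_second_moment :
  \int[Q]_z (score z ^+ 2) <=
  2 * (2 * B ^+ 2 + 2 * B) ^+ 2 * treatment_prob Q a + 8 * B ^+ 2 * wh.
Proof.
set C := 2 * (2 * B ^+ 2 + 2 * B) ^+ 2.
have ci : Q.-integrable setT (EFin \o (fun=> 8 * B ^+ 2 * wh)).
  exact: finite_measure_integrable_cst.
have ti : Q.-integrable setT (EFin \o (fun z => C * treated a z)).
  exact: (integrableZl measurableT C (integrable_treated a)).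
have s2i : Q.-integrable setT (EFin \o (fun z => score z ^+ 2)).
  apply: (@integrable_ae_bounded _ _ _ _ _ ((2 * B ^+ 2 + 4 * B) ^+ 2)).
    apply: measurable_funX; exact: measurable_score.
  apply: filterS ae_score_bounded => z sz.
  by rewrite normrX lerXn2r// ?nnegrE// (le_trans _ sz).
have -> : C * treatment_prob Q a + 8 * B ^+ 2 * wh =
    \int[Q]_z (C * treated a z + 8 * B ^+ 2 * wh).
  rewrite RintegralD// RintegralZl//; last exact: integrable_treated.
  by rewrite Rintegral_treated Rintegral_probability_cst.
rewrite -lee_fin !EFin_Rintegral//; last exact: (integrableD measurableT ti ci).
apply: ae_ge0_le_integral => //.
- by move=> z _; rewrite lee_fin sqr_ge0.
- by have /integrableP[] := s2i.
- move=> z _; rewrite lee_fin; apply: addr_ge0.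
    by apply: mulr_ge0; [apply: mulr_ge0 => //; exact: sqr_ge0|rewrite /treated].
  by apply: mulr_ge0 => //; apply: mulr_ge0 => //; exact: sqr_ge0.
- by have /integrableP[] := integrableD measurableT ti ci.
- apply: filterS ae_score_parts => z [h1 h2] _; rewrite lee_fin scoreE.
  set p := _ - psi a in h1 *; set q := _ - psi0 in h2 *.
  have p2 : p ^+ 2 <= (2 * B ^+ 2 + 2 * B) ^+ 2.
    by rewrite -(real_normK (num_real p)) lerXn2r// nnegrE// (le_trans _ h1).
  have q2 : q ^+ 2 <= (2 * B) ^+ 2.
    by rewrite -(real_normK (num_real q)) lerXn2r// nnegrE// (le_trans _ h2).
  apply: (@le_trans _ _ (2 * (treated a z * p) ^+ 2 + 2 * (wh * q) ^+ 2)).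
    by rewrite -subr_ge0 (_ : _ - _ = (treated a z * p - wh * q) ^+ 2);
      [exact: sqr_ge0|ring].
  apply: lerD.
    rewrite exprMn (_ : treated a z ^+ 2 = treated a z); last first.
      by rewrite /treated; case: (_ == _); rewrite /= ?expr1n ?expr0n.
    by rewrite /C [X in _ <= X]mulrAC mulrA ler_wpM2l// mulr_ge0// /treated.
  rewrite (_ : 8 * B ^+ 2 * wh = 2 * (wh * (2 * B) ^+ 2)); last by ring.
  rewrite ler_wpM2l// exprMn; apply: ler_pM => //; rewrite ?sqr_ge0//.
  by rewrite expr2 ler_piMl.
Qed.

(** The integrand is wh times the product of the relative error on pi_a and of
    the error on mu_a, to which the Cauchy-Schwarz inequality applies. *)
Lemma propensity_error_bound (delta eps : R) :
  (L2norm Q (fun x => pi a x / ph x - 1)%R <= delta%:E)%E ->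
  (L2norm Q (fun x => mu a x - mh x)%R <= eps%:E)%E ->
  `|\int[Q]_z ((pi a (cov z) * (wh / ph (cov z)) - wh)
      * (mu a (cov z) - mh (cov z)))| <= wh * (delta * eps).
Proof.
move=> hdelta heps.
pose f (z : obs) := pi a (cov z) / ph (cov z) - 1.
pose g (z : obs) := mu a (cov z) - mh (cov z).
have mpih : measurable_fun [set: obs] (fun z => pi a (cov z)).
  exact: (measurableT_comp (measurable_propensity a) measurable_cov).
have mmuc : measurable_fun [set: obs] (fun z => mu a (cov z)).
  exact: (measurableT_comp (measurable_regression a) measurable_cov).
have mmhc : measurable_fun [set: obs] (fun z => mh (cov z)).
  exact: (measurableT_comp mmh measurable_cov).
have mphc : measurable_fun [set: obs] (fun z => ph (cov z)).
  exact: (measurableT_comp mph measurable_cov).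
have mf : measurable_fun [set: obs] f.
  apply: measurable_funB; last exact: measurable_cst.
  apply: measurable_funM => //.
  exact: (measurableT_comp (@measurable_inv R) mphc).
have mg : measurable_fun [set: obs] g by exact: measurable_funB.
have fgle : (\int[Q]_z `|(f z * g z)%:E| <= (delta * eps)%:E)%E.
  have two0 : 0 < 2 :> R by [].
  have twoV : 2^-1 + 2^-1 = 1 :> R by lra.
  have := hoelder Q mf mg two0 two0 twoV; rewrite Lnorm1 => /le_trans; apply.
  by rewrite EFinM; apply: lee_pmul => //; exact: Lnorm_ge0.
have mF : measurable_fun [set: obs] (fun z => wh * (f z * g z)).
  by apply: measurable_funM; [exact: measurable_cst|exact: measurable_funM].
have Fle : (\int[Q]_z `|(wh * (f z * g z))%:E| <= (wh * (delta * eps))%:E)%E.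
  under eq_integral do rewrite EFinM abseM gee0_abs ?lee_fin//.
  rewrite ge0_integralZl_EFin//.
    by rewrite EFinM lee_wpmul2l// lee_fin.
  apply: measurableT_comp => //; apply/measurable_EFinP; exact: measurable_funM.
have Fi : Q.-integrable setT (EFin \o (fun z => wh * (f z * g z))).
  apply/integrableP; split; first exact/measurable_EFinP.
  by rewrite (le_lt_trans Fle)// ltry.
have -> : \int[Q]_z ((pi a (cov z) * (wh / ph (cov z)) - wh)
      * (mu a (cov z) - mh (cov z))) = \int[Q]_z (wh * (f z * g z)).
  by apply: eq_Rintegral => z _; rewrite /f /g; ring.
apply: (le_trans (le_normr_Rintegral measurableT Fi)).
by rewrite -lee_fin EFin_Rintegral//; exact: integrable_norm.
Qed.

(** The score is doubly robust: replacing Y by mu_a(X) and the treatment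
    indicator by pi_a(X) is exact on average, and what remains is the product
    of the two estimation errors, plus the error made on P(A = a), which
    multiplies psi a. *)
Lemma score_mean_bound (delta eps : R) :
  (L2norm Q (fun x => pi a x / ph x - 1)%R <= delta%:E)%E ->
  (L2norm Q (fun x => mu a x - mh x)%R <= eps%:E)%E ->
  `|\int[Q]_z score z| <= wh * (delta * eps) + 2 * B * `|wh - treatment_prob Q a|.
Proof.
move=> hdelta heps.
have muB := regression_bounded a.
have mpih : measurable_fun [set: obs] (fun z => pi a (cov z)).
  exact: (measurableT_comp (measurable_propensity a) measurable_cov).
have mmuc : measurable_fun [set: obs] (fun z => mu a (cov z)).
  exact: (measurableT_comp (measurable_regression a) measurable_cov).
have mmhc : measurable_fun [set: obs] (fun z => mh (cov z)).
  exact: (measurableT_comp mmh measurable_cov).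
have mh' : measurable_fun [set: covariate R d] (fun x => wh / ph x).
  by apply: measurable_funM => //; exact: (measurableT_comp (@measurable_inv R) mph).
have mhc : measurable_fun [set: obs] (fun z => wh / ph (cov z)).
  exact: (measurableT_comp mh' measurable_cov).
have mt : measurable_fun [set: obs] (fun z => treated a z : R).
  exact: measurable_treated.
(* s1 and s2 are the two conditionally centered parts of the score, s3 is
   the product of the errors, s4 + s5 has mean (wh - P(A = a)) psi_a. *)
pose s1 (z : obs) := treated a z * (wh / ph (cov z)) * (outcome z - mu (trt z) (cov z)).
pose s2 (z : obs) := wh / ph (cov z) * (mu a (cov z) - mh (cov z))
  * (treated a z - pi a (cov z)).
pose s3 (z : obs) := (pi a (cov z) * (wh / ph (cov z)) - wh)
  * (mu a (cov z) - mh (cov z)).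
pose s4 (z : obs) := wh * (mu a (cov z) - psi0).
pose s5 (z : obs) := - psi a * treated a z.
have scoreE5 z : score z = s1 z + s2 z + s3 z + s4 z + s5 z.
  rewrite scoreE /s1 /s2 /s3 /s4 /s5 /treated; case: eqP => [->|_] /=; ring.
have B0 : 0 <= B by exact: le_trans psi0_bounded.
have sub2 (x y : R) : `|x| <= B -> `|y| <= B -> `|x - y| <= 2 * B.
  by move=> ? ?; rewrite (le_trans (ler_normB _ _))// mulrDl mul1r lerD.
have mutB : {ae Q, forall z, forall b, `|mu b (cov z)| <= B}.
  by apply: filter_forall => b; exact: regression_bounded.
have mmut : measurable_fun [set: obs] (fun z => mu (trt z) (cov z)).
  by have [mmu _ _] := condmu; exact: (measurableT_comp mmu measurable_pair_cov_trt).
have is1 : Q.-integrable setT (EFin \o s1).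
  apply: (@integrable_ae_bounded _ _ _ _ _ (1 * B * (2 * B))).
    apply: measurable_funM; first exact: measurable_funM.
    by apply: measurable_funB => //; exact: measurable_outcome.
  apply: filterS3 weight_bounded mutB outcome_bounded => z hB mB yB.
  rewrite /s1 normrM [X in X * _]normrM; apply: ler_pM => //; last exact: sub2.
  by apply: ler_pM => //; exact: treated_le1.
have is2 : Q.-integrable setT (EFin \o s2).
  apply: (@integrable_ae_bounded _ _ _ _ _ (B * (2 * B) * 2)).
    apply: measurable_funM; last exact: measurable_funB.
    by apply: measurable_funM => //; exact: measurable_funB.
  near=> z; rewrite /s2 normrM [X in X * _]normrM; apply: ler_pM => //.
    apply: ler_pM => //; first by near: z.
    by apply: sub2; near: z.
  rewrite (le_trans (ler_normB _ _))// (_ : 2 = 1 + 1 :> R)// lerD//.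
    exact: treated_le1.
  by near: z; exact: propensity_le1.
have is3 : Q.-integrable setT (EFin \o s3).
  apply: (@integrable_ae_bounded _ _ _ _ _ ((1 * B + 1) * (2 * B))).
    apply: measurable_funM; last exact: measurable_funB.
    by apply: measurable_funB => //; exact: measurable_funM.
  near=> z; rewrite /s3 normrM; apply: ler_pM => //.
    rewrite (le_trans (ler_normB _ _))// lerD// ?(ger0_norm wh_ge0)// normrM.
    apply: ler_pM => //; last by near: z.
    by near: z; exact: propensity_le1.
  by apply: sub2; near: z.
have is4 : Q.-integrable setT (EFin \o s4).
  apply: (@integrable_ae_bounded _ _ _ _ _ (1 * (2 * B))).
    by apply: measurable_funM => //; exact: measurable_funB.
  apply: filterS muB => z mB; rewrite /s4 normrM; apply: ler_pM => //.
    by rewrite ger0_norm.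
  exact: sub2.
have is5 : Q.-integrable setT (EFin \o s5).
  exact: (integrableZl measurableT (- psi a) (integrable_treated a)).
have I1 : \int[Q]_z s1 z = 0.
  have Yi := integrable_ae_bounded measurable_outcome outcome_bounded.
  have cY := cond_expectation_centered measurable_pair_cov_trt Yi condmu.
  pose G (u : covariate R d * 'I_k.+1) : R := (u.2 == a)%:R * (wh / ph u.1).
  apply: (centered_orthogonal measurable_pair_cov_trt cY (G := G) (M := 1 * B)).
  - apply: measurable_funM.
      exact: (measurableT_comp (measurable_treatment_indicator a) measurable_snd).
    exact: (measurableT_comp mh' measurable_fst).
  - apply: filterS weight_bounded => z hB; rewrite /G normrM.
    by apply: ler_pM => //; exact: treated_le1.
  - by apply: measurable_funB => //; exact: measurable_outcome.
have I2 : \int[Q]_z s2 z = 0.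
  apply: (@treated_orthogonal a (fun x => wh / ph x * (mu a x - mh x)) (B * (2 * B))).
    apply: measurable_funM => //; apply: measurable_funB => //.
    exact: measurable_regression.
  apply: filterS3 weight_bounded mh_bounded muB => z hB mB rB.
  by rewrite normrM; apply: ler_pM => //; exact: sub2.
have I4 : \int[Q]_z s4 z = wh * psi a.
  have ci : Q.-integrable setT (EFin \o (fun=> psi0)).
    exact: finite_measure_integrable_cst.
  have ri := integrable_regression a.
  rewrite RintegralZl//; last exact: (integrableB measurableT ri ci).
  rewrite (RintegralB measurableT ri ci) Rintegral_regression.
  by rewrite Rintegral_probability_cst; congr (_ * _); ring.
have I5 : \int[Q]_z s5 z = - psi a * treatment_prob Q a.
  by rewrite RintegralZl// ?Rintegral_treated//; exact: integrable_treated.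
have -> : \int[Q]_z score z = \int[Q]_z s3 z + psi a * (wh - treatment_prob Q a).
  under eq_Rintegral do rewrite scoreE5.
  have i12 := integrableD measurableT is1 is2.
  have i123 := integrableD measurableT i12 is3.
  have i1234 := integrableD measurableT i123 is4.
  rewrite (RintegralD measurableT i1234 is5) (RintegralD measurableT i123 is4).
  rewrite (RintegralD measurableT i12 is3) (RintegralD measurableT is1 is2).
  rewrite I1 I2 I4 I5; ring.
rewrite (le_trans (ler_normD _ _))// lerD//.
  exact: propensity_error_bound.
by rewrite normrM ler_wpM2r// effect_bounded.
Unshelve. all: by end_near. Qed.


End SingleScore.

End ScoreMoments.

(** * Exponential bounds on deviations *)

Section DominatedMean.
Context {R : realType} {dO : measure_display} {Omega : measurableType dO}.
Variable P : probability Omega R.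

(** Upper bounds on means of nonnegative variables, in a form closed under
    sums and products by constants: the loss is dominated by a linear
    combination of exponentials, whose means are bounded one by one. *)
Definition dominated_mean (f : Omega -> R) (b : R) : Prop :=
  [/\ measurable_fun [set: Omega] f, (forall w, 0 <= f w) &
      (\int[P]_w (f w)%:E <= b%:E)%E].

Lemma dominated_mean_cst (r : R) : 0 <= r -> dominated_mean (fun=> r) r.
Proof.
move=> r0; split=> //.
by rewrite integral_cst// [X in (_ * X)%E]probability_setT mule1.
Qed.

Lemma dominated_meanD f g a b : dominated_mean f a -> dominated_mean g b ->
  dominated_mean (fun w => f w + g w) (a + b).
Proof.
move=> [mf f0 fa] [mg g0 gb]; split=> [||].
- exact: measurable_funD.
- by move=> w; rewrite addr_ge0.
- under eq_integral do rewrite EFinD.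
  rewrite ge0_integralD//; [|by move=> w _; rewrite lee_fin|exact/measurable_EFinP
    |by move=> w _; rewrite lee_fin|exact/measurable_EFinP].
  by rewrite EFinD leeD.
Qed.

Lemma dominated_meanZ f a r : 0 <= r -> dominated_mean f a ->
  dominated_mean (fun w => r * f w) (r * a).
Proof.
move=> r0 [mf f0 fa]; split=> [||].
- by apply: measurable_funM => //; exact: measurable_cst.
- by move=> w; rewrite mulr_ge0.
- under eq_integral do rewrite EFinM.
  rewrite ge0_integralZl_EFin//; [|by move=> w _; rewrite lee_fin|exact/measurable_EFinP].
  by rewrite EFinM lee_wpmul2l.
Qed.

Lemma dominated_mean_le f a b : a <= b -> dominated_mean f a -> dominated_mean f b.
Proof. by move=> ab [mf f0 fa]; split=> //; rewrite (le_trans fa)// lee_fin. Qed.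

Lemma dominated_mean_sum (I : finType) (f : I -> Omega -> R) (b : R) :
  (forall i, dominated_mean (f i) b) ->
  dominated_mean (fun w => \sum_i f i w) (#|I|%:R * b).
Proof.
move=> fb; split=> [||].
- by apply: measurable_sum => i; have [] := fb i.
- by move=> w; apply: sumr_ge0 => i _; have [_ ->] := fb i.
- under eq_integral do rewrite -sumEFin.
  rewrite ge0_integral_sum//.
  + rewrite mulr_natl -sumr_const -sumEFin; apply: lee_sum => i _.
    by have [_ _] := fb i.
  + by move=> i; apply/measurable_EFinP; have [] := fb i.
  + by move=> i w _; rewrite lee_fin; have [_ ->] := fb i.
Qed.

End DominatedMean.

Lemma iid_samples_swap (R : realType) (dO d : measure_display)
    (Omega : measurableType dO) (T : measurableType d) (n : nat)
    (P : probability Omega R) (Q : probability T R)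
    (D1 D2 : Omega -> n.-tuple T) :
  independent_iid_samples P Q D1 D2 -> independent_iid_samples P Q D2 D1.
Proof.
pose sw (i : 'I_n + 'I_n) : 'I_n + 'I_n :=
  match i with inl j => inr j | inr j => inl j end.
have swK : involutive sw by case.
have pooledE i : pooled D2 D1 i = pooled D1 D2 (sw i) by case: i.
move=> [ind law]; split=> [J E mE|i E mE]; last by rewrite pooledE law.
pose J' := [set sw i | i in J]%SET.
have J'E i : (i \in J') = (sw i \in J).
  by rewrite -[i in LHS]swK mem_imset//; exact: inv_inj.
have := ind J' (E \o sw) (fun i => mE (sw i)).
rewrite (_ : \bigcap_(i in [set` J']) _ =
  \bigcap_(i in [set` J]) (pooled D2 D1 i @^-1` E i)); last first.
  apply/seteqP; split=> w /= h i iJ.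
    rewrite pooledE; have siJ : sw i \in J' by rewrite J'E swK.
    by have := h _ siJ; rewrite /preimage/= swK.
  have siJ : sw i \in J by rewrite -J'E.
  by have := h _ siJ; rewrite /preimage/= pooledE swK.
move=> ->; rewrite (reindex_inj (inv_inj swK))/=.
by apply: eq_big => [i|i _]; rewrite ?J'E ?swK// pooledE.
Qed.

Section Deviations.
Context {R : realType} {dO d : measure_display}.
Context {Omega : measurableType dO} {T : measurableType d} {n : nat}.
Variables (P : probability Omega R) (Q : probability T R).
Variables (D1 D2 : Omega -> n.-tuple T).
Hypotheses (mD1 : measurable_fun [set: Omega] D1)
  (mD2 : measurable_fun [set: Omega] D2).
Hypothesis iid : independent_iid_samples P Q D1 D2.
Variables (keep : n.-tuple T -> bool) (f : n.-tuple T -> T -> R).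
Hypothesis mkeep : measurable_fun [set: n.-tuple T] keep.
Hypothesis mf :
  measurable_fun [set: (n.-tuple T * T)%type] (fun u => f u.1 u.2).

(** The event keep only depends on the first sample; it is where the second
    moment of f is under control. *)
Definition deviation (w : Omega) : R :=
  if keep (D1 w) then
    \sum_(i < n) (f (D1 w) (tnth (D2 w) i) - \int[Q]_z f (D1 w) z)
  else 0.

Lemma measurable_conditional_mean :
  measurable_fun [set: n.-tuple T] (fun t => \int[Q]_z f t z).
Proof.
pose g (u : (n.-tuple T * T)%type) : \bar R := (f u.1 u.2)%:E.
have mg : measurable_fun [set: (n.-tuple T * T)%type] g by exact/measurable_EFinP.
have mp := measurable_fun_fubini_tonelli_F (m2 := Q) _
  (measurable_funepos mg) (funepos_ge0 g).
have mn := measurable_fun_fubini_tonelli_F (m2 := Q) _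
  (measurable_funeneg mg) (funeneg_ge0 g).
apply: (measurableT_comp (fine_measurable measurableT)).
rewrite (_ : (fun t => _) = fubini_F Q g^\+ \- fubini_F Q g^\-)%E.
  exact: emeasurable_funB.
apply/funext => t; rewrite [LHS]integralE /fubini_F.
by congr (_ - _)%E; apply: eq_integral => z _; rewrite ?funeposE ?funenegE.
Qed.

(** Given D1 the deviation is a sum of centered i.i.d. variables, so that its
    exponential moment is bounded by the n-th power of the bound for one
    observation. *)
Lemma exp_deviation_mean (M v eta : R) : `|eta| * M <= 2^-1 -> 0 <= v ->
  {ae P, forall w, keep (D1 w) ->
    {ae Q, forall z, `|f (D1 w) z| <= M} /\ \int[Q]_z (f (D1 w) z ^+ 2) <= v} ->
  dominated_mean P (fun w => expR (eta * deviation w))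
    (expR (n%:R * (2 * eta ^+ 2 * v))).
Proof.
move=> etaM v0 aef.
pose F t z := expR (eta * (if keep t then f t z - \int[Q]_y f t y else 0)).
have mF : measurable_fun [set: (n.-tuple T * T)%type] (fun u => F u.1 u.2).
  apply: measurableT_comp => //; apply: measurable_funM; first exact: measurable_cst.
  apply: measurable_fun_ifT.
  - exact: (measurableT_comp mkeep measurable_fst).
  - apply: measurable_funB => //.
    exact: (measurableT_comp measurable_conditional_mean measurable_fst).
  - exact: measurable_cst.
have devE w : expR (eta * deviation w) = \prod_(i < n) F (D1 w) (tnth (D2 w) i).
  rewrite /F -expR_sum -mulr_sumr /deviation; case: (keep (D1 w)) => //.
  by rewrite big1.
have mFw : measurable_fun [set: Omega] (fun w => expR (eta * deviation w)).
  rewrite (funext devE); apply: measurable_prod => i _.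
  have m2 : measurable_fun [set: Omega] (fun w => (D1 w, tnth (D2 w) i)).
    apply: measurable_fun_pair => //.
    exact: (measurableT_comp (measurable_tnth i) mD2).
  exact: (measurableT_comp mF m2).
split=> //.
rewrite expRM_natl; under eq_integral do rewrite devE.
apply: (prod_moment_le mD1 mD2 iid) => // [t z|]; first exact: expR_ge0.
apply: filterS aef => w; rewrite /F; case: (keep (D1 w)) => [/(_ isT)[fM fv]|_].
  apply: (centered_exp_moment_le _ fM etaM fv).
  exact: (measurable_fun_pair2 (D1 w) mf).
under eq_integral do rewrite mulr0 expR0.
rewrite integral_cst// [X in (_ * X)%E]probability_setT mule1 lee_fin.
rewrite -[X in X <= _]expR0 ler_expR; apply: mulr_ge0 => //.
by apply: mulr_ge0 => //; exact: sqr_ge0.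
Qed.

End Deviations.

(** A substitute for the integration of tails: it is the pointwise form of
    E r^2 <= L^2 + E(r^2; |r| > L), the second term being bounded by an
    exponential with the damping factor exp (- l L / 2).  With l = ln k this
    factor beats the union bound over the k treatments once L is large. *)
Lemma sqr_le_exp_tail (R : realType) (l L r : R) : 2^-1 <= l -> 0 <= L ->
  r ^+ 2 <= L ^+ 2 + 32 * expR (- (l * L / 2)) * (expR (l * r) + expR (- l * r)).
Proof.
move=> l2 L0; have l0 : 0 <= l by exact: le_trans l2.
have c0 : 0 <= 32 * expR (- (l * L / 2)) by rewrite mulr_ge0// expR_ge0.
have [rL|Lr] := leP `|r| L.
  have r2 : r ^+ 2 <= L ^+ 2.
    by rewrite -(real_normK (num_real r)) lerXn2r// nnegrE.
  by rewrite -[leLHS]addr0 lerD// mulr_ge0// addr_ge0// expR_ge0.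
rewrite -[leLHS]add0r lerD ?sqr_ge0//.
apply: (@le_trans _ _ (32 * expR (l * `|r| / 2))).
  have := expR_ge1Dxn 1 (_ : 0 <= l * `|r| / 2).
  rewrite divr_ge0 ?mulr_ge0// => /(_ isT); rewrite (_ : 2`!%:R = 2 :> R)// => e2.
  have r1 : (l * `|r|) ^+ 2 = l ^+ 2 * r ^+ 2.
    by rewrite exprMn real_normK// num_real.
  have : 2^-1 ^+ 2 * r ^+ 2 <= (l * `|r|) ^+ 2.
    by rewrite r1 ler_wpM2r ?sqr_ge0// lerXn2r// nnegrE.
  move: e2; rewrite expr_div_n; lra.
rewrite -[leRHS]mulrA ler_wpM2l//.
apply: (@le_trans _ _ (expR (- (l * L / 2)) * expR (l * `|r|))).
  rewrite -expRD ler_expR.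
  have : l * L <= l * `|r| by rewrite ler_wpM2l// ltW.
  lra.
rewrite ler_wpM2l ?expR_ge0//; case: (ler0P r) => _.
  by rewrite mulrN -mulNr lerDr expR_ge0.
by rewrite lerDl expR_ge0.
Qed.

(** * The loss on given samples *)

Section EmpiricalRiskAlgebra.
Context {R : realType} {d k n : nat}.
Local Notation obs := (observation R d k).
Variables (psi0 : R) (muhat pihat : estimator R d k n).
Implicit Types D : n.-tuple obs.

(** Up to the factor -2 this is the coefficient of b_a in the empirical risk;
    given D1 it estimates psi_a times the frequency of a in D1. *)
Definition weighted_effect D1 D2 (a : 'I_k.+1) : R :=
  sample_mean D2 (fun z =>
    ((trt z == a)%:R / pihat a D1 (cov z) * (outcome z - muhat a D1 (cov z))
      + muhat a D1 (cov z) - psi0) * treatment_freq D1 a).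

Lemma empirical_riskE D1 D2 :
  empirical_risk psi0 muhat pihat D1 D2 =
  quadratic_risk (treatment_freq D2) (weighted_effect D1 D2).
Proof.
apply/funext => b; rewrite /empirical_risk /quadratic_risk /treatment_freq.
rewrite /weighted_effect /sample_mean.
pose X a i := (trt (tnth D2 i) == a)%:R / pihat a D1 (cov (tnth D2 i))
  * (outcome (tnth D2 i) - muhat a D1 (cov (tnth D2 i)))
  + muhat a D1 (cov (tnth D2 i)) - psi0.
transitivity (\sum_(a < k.+1) n%:R^-1 * \sum_(i < n)
    ((trt (tnth D2 i) == a)%:R * b a ^+ 2
     - 2 * (X a i * treatment_freq D1 a * b a))); last first.
  apply: eq_bigr => a _; rewrite sumrB mulrBr -mulr_suml -mulr_sumr -mulr_suml.
  by rewrite /X /treatment_freq /sample_mean; ring.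
rewrite -mulr_sumr exchange_big/=; congr (_ * _); apply: eq_bigr => i _.
rewrite sumrB addrC -mulr_sumr; congr (_ + _); last first.
  by rewrite -mulNr; congr (_ * _); apply: eq_bigr => a _; rewrite mulrAC.
rewrite (bigD1 (trt (tnth D2 i)))//= eqxx mul1r big1 ?addr0// => a ai.
by rewrite eq_sym (negbTE ai) mul0r.
Qed.

Lemma weighted_effect_residual (psi : 'I_k.+1 -> R) D1 D2 a :
  weighted_effect D1 D2 a - treatment_freq D2 a * psi a =
  sample_mean D2
    (score psi0 psi a (treatment_freq D1 a) (muhat a D1) (pihat a D1)).
Proof.
rewrite /weighted_effect /treatment_freq /sample_mean -mulrA -mulrBr.
by rewrite mulr_suml -sumrB.
Qed.

Lemma treatment_freq_ge0 D1 a : 0 <= treatment_freq D1 a.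
Proof. by rewrite /treatment_freq/sample_mean mulr_ge0 ?invr_ge0// sumr_ge0. Qed.

Lemma treatment_freq_le1 D1 a : treatment_freq D1 a <= 1.
Proof.
rewrite /treatment_freq/sample_mean; have [n0|n0] := posnP n.
  by rewrite (_ : n%:R^-1 = 0 :> R) ?mul0r// n0 invr0.
rewrite ler_pdivrMl ?ltr0n// mulr1.
apply: (@le_trans _ _ (\sum_(i < n) 1)); last by rewrite sumr_const card_ord.
by apply: ler_sum => i _; case: (_ == _).
Qed.

End EmpiricalRiskAlgebra.

Section EstimationError.
Context {R : realType} {d k n : nat}.
Local Notation obs := (observation R d k).
Variables (psi0 : R) (muhat pihat : estimator R d k n) (s : nat).
Variables (psi b prob : 'I_k.+1 -> R) (D1 D2 : n.-tuple obs).
Variables (c C B : R).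
Hypotheses (c0 : 0 < c) (C0 : 0 < C) (B0 : 0 < B).
Hypothesis prob_bounds : forall a, c / k.+1%:R <= prob a <= C / k.+1%:R.
Hypothesis psi_sparse : (l0norm psi <= s)%N.
Local Notation risk := (empirical_risk psi0 muhat pihat D1 D2).
Hypothesis b_estimates :
  lasso_argmin (l1norm psi) risk b \/ is_subset_estimate s D2 risk b.

Let k0 : 0 < k.+1%:R :> R.
Proof. by rewrite ltr0n. Qed.

Let loss := \sum_(a < k.+1) prob a * (b a - psi a) ^+ 2.

Lemma loss_le_sqr_error :
  loss <= C / k.+1%:R * \sum_(a < k.+1) (b a - psi a) ^+ 2.
Proof.
rewrite mulr_sumr; apply: ler_sum => a _; rewrite ler_wpM2r ?sqr_ge0//.
by have /andP[] := prob_bounds a.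
Qed.

(** When every treatment has at least half its expected frequency in D2, the
    risk is curved with curvature of order 1 / k, and k s G bounds the loss, up
    to a constant, as soon as G bounds the squares of the coordinates
    th_a - q_a psi_a of the gradient.  The best subset estimate is then a true
    minimiser, as one exists. *)
Lemma loss_le_balanced (G : R) :
  (forall a, prob a / 2 <= treatment_freq D2 a) ->
  (forall a, (weighted_effect psi0 muhat pihat D1 D2 a
     - treatment_freq D2 a * psi a) ^+ 2 <= G) ->
  loss <= 64 * C / c ^+ 2 * (k.+1%:R * s%:R * G).
Proof.
move=> bal gG; pose kappa := c / k.+1%:R / 2.
have kappa0 : 0 < kappa by rewrite !divr_gt0.
have kappaq a : kappa <= treatment_freq D2 a.
  apply: le_trans (bal a); rewrite ler_wpM2r ?invr_ge0//.
  by have /andP[] := prob_bounds a.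
have G0 : 0 <= G by apply: le_trans (gG ord0); exact: sqr_ge0.
have gsqrt a : `|weighted_effect psi0 muhat pihat D1 D2 a
     - treatment_freq D2 a * psi a| <= Num.sqrt G.
  by rewrite -sqrtr_sqr ler_sqrt.
have [min cone] : risk b <= risk psi /\
    l1norm (fun a => b a - psi a) ^+ 2 <=
    4 * s%:R * \sum_(a < k.+1) (b a - psi a) ^+ 2.
  case: b_estimates => [[/= bl bmin]|[bsub _]].
    split; first exact: bmin.
    apply: le_trans (lasso_error_cone bl) _.
    apply: ler_wpM2r; first by apply: sumr_ge0 => a _; exact: sqr_ge0.
    by rewrite ler_wpM2l// ler_nat.
  have ne : subset_argmin s risk !=set0.
    rewrite empirical_riskE; apply: subset_argmin_exists => a.
    exact: lt_le_trans (kappaq a).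
  have [[/= bs bmin] _] := bsub ne; split; first exact: bmin.
  exact: l0norm_error_cone.
rewrite empirical_riskE in min.
have := sparse_error_bound kappa0 kappaq gsqrt min cone.
rewrite sqr_sqrtr// => h.
apply: le_trans loss_le_sqr_error _.
rewrite -(ler_pM2l (exprn_gt0 2 kappa0)).
rewrite [leLHS]mulrCA.
apply: (@le_trans _ _ (C / k.+1%:R * (16 * s%:R * G))).
  by rewrite ler_wpM2l// divr_ge0// ltW.
rewrite le_eqVlt; apply/orP; left; apply/eqP; rewrite /kappa; field.
by rewrite !gt_eqF.
Qed.

Hypothesis psi_bounded : forall a, `|psi a| <= 2 * B.
Hypothesis outcome_bounded : forall i, `|outcome (tnth D2 i)| <= B.
Hypothesis psi0_bounded : `|psi0| <= B.
Hypothesis muhat_bounded : forall a i, `|muhat a D1 (cov (tnth D2 i))| <= B.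
Hypothesis weight_bounded : forall a i,
  `|treatment_freq D1 a / pihat a D1 (cov (tnth D2 i))| <= B.
Hypothesis n0 : (0 < n)%N.

Lemma weighted_effect_bounded a :
  `|weighted_effect psi0 muhat pihat D1 D2 a| <=
  2 * B ^+ 2 * treatment_freq D2 a + 2 * B.
Proof.
have n0' : 0 < n%:R :> R by rewrite ltr0n.
have sub2 (x y : R) : `|x| <= B -> `|y| <= B -> `|x - y| <= 2 * B.
  by move=> ? ?; rewrite (le_trans (ler_normB _ _))// mulrDl mul1r lerD.
have -> : 2 * B ^+ 2 * treatment_freq D2 a + 2 * B = n%:R^-1 *
    \sum_(i < n) (2 * B ^+ 2 * (trt (tnth D2 i) == a)%:R + 2 * B).
  rewrite big_split/= -mulr_sumr sumr_const card_ord -[X in _ * (_ + X)]mulr_natl.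
  by rewrite /treatment_freq /sample_mean; field; rewrite gt_eqF.
rewrite /weighted_effect /sample_mean normrM ger0_norm ?invr_ge0//.
rewrite ler_wpM2l ?invr_ge0//; apply: le_trans (ler_norm_sum _ _ _) _.
apply: ler_sum => i _; set t := (trt _ == a)%:R.
have t0 : 0 <= t by rewrite /t.
rewrite (_ : _ * _ = t * (treatment_freq D1 a / pihat a D1 (cov (tnth D2 i))
   * (outcome (tnth D2 i) - muhat a D1 (cov (tnth D2 i))))
   + treatment_freq D1 a * (muhat a D1 (cov (tnth D2 i)) - psi0)); last by ring.
rewrite (le_trans (ler_normD _ _))//; apply: lerD; rewrite normrM.
  rewrite (ger0_norm t0) mulrC ler_wpM2r// normrM.
  rewrite (_ : 2 * B ^+ 2 = B * (2 * B)); last by ring.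
  by apply: ler_pM => //; exact: sub2.
rewrite -[leRHS]mul1r ger0_norm ?treatment_freq_ge0//.
apply: ler_pM => //; first exact: treatment_freq_ge0.
  exact: treatment_freq_le1.
exact: sub2.
Qed.

Lemma treatment_freq_ge_inv a i : trt (tnth D2 i) = a ->
  n%:R^-1 <= treatment_freq D2 a.
Proof.
move=> ia; rewrite /treatment_freq /sample_mean -[leLHS]mulr1 ler_wpM2l ?invr_ge0//.
by rewrite (bigD1 i)//= ia eqxx lerDl sumr_ge0.
Qed.

(** A nonzero coordinate belongs to a treatment seen in D2, whose frequency
    is at least 1 / n. *)
Lemma estimate_coordinate_bounded a : is_subset_estimate s D2 risk b ->
  `|b a| <= 2 * B ^+ 2 + 2 * B * n%:R.
Proof.
move=> [bne b0]; have n0' : 0 < n%:R :> R by rewrite ltr0n.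
have bd0 : 0 <= 2 * B ^+ 2 + 2 * B * n%:R.
  by rewrite addr_ge0// !mulr_ge0// ltW// exprn_gt0.
have [->|ba0] := eqVneq (b a) 0; first by rewrite normr0.
have [e|/set0P ne] := eqVneq (subset_argmin s risk) set0.
  by rewrite b0// eqxx in ba0.
have [bmin bmiss] := bne ne.
have [i ia] : exists i, trt (tnth D2 i) = a.
  apply: contrapT => h; move/eqP : ba0; apply; apply: bmiss => i.
  by apply/eqP => ia; apply: h; exists i.
have qn := treatment_freq_ge_inv ia.
have q0 : 0 < treatment_freq D2 a by rewrite (lt_le_trans _ qn)// invr_gt0.
rewrite empirical_riskE in bmin.
rewrite (subset_argmin_coordinate bmin q0 ba0) normrM.
rewrite (gtr0_norm (x := _^-1)) ?invr_gt0//.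
rewrite ler_pdivrMr//; apply: le_trans (weighted_effect_bounded a) _.
rewrite [leRHS]mulrDl; apply: lerD => //; rewrite -[leRHS]mulrA.
rewrite ler_peMr ?mulr_ge0 ?(ltW B0)// -(ler_pM2l (_ : 0 < n%:R^-1)) ?invr_gt0//.
by rewrite mulr1 mulKf ?gt_eqF.
Qed.

(** This bound does not require the samples to be balanced; it serves on the
    event of small probability where they are not.  Both estimators give it the
    factor s: the lasso through |psi|_1 <= 2 B |psi|_0, the best subset
    estimate through the size of the support of the error. *)
Lemma loss_le_crude :
  loss <= C * (16 * B ^+ 2 + 2 * (2 * B ^+ 2 + 4 * B) ^+ 2) * (s%:R * n%:R ^+ 2).
Proof.
have n1 : 1 <= n%:R :> R by rewrite ler1n.
have B0' := ltW B0.
set M := 2 * B ^+ 2 + 4 * B.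
have sq0 : 0 <= \sum_(a < k.+1) (b a - psi a) ^+ 2.
  by apply: sumr_ge0 => a _; exact: sqr_ge0.
have sn0 : 0 <= s%:R * n%:R ^+ 2 :> R by rewrite mulr_ge0// exprn_ge0.
apply: le_trans loss_le_sqr_error _.
case: b_estimates => [[/= bl _]|bsub].
  pose S := [set a | psi a != 0]%SET.
  have psiS a : a \notin S -> psi a = 0 by rewrite inE negbK => /eqP.
  have lpsi : l1norm psi <= 2 * B * (l0norm psi)%:R.
    rewrite /l1norm (sum_support (normr0 _) psiS) mulr_natr -sumr_const.
    exact: ler_sum.
  have lpsi2 : (2 * l1norm psi) ^+ 2 <= 16 * B ^+ 2 * (s%:R * k.+1%:R).
    apply: (@le_trans _ _ ((2 * (2 * B * (l0norm psi)%:R)) ^+ 2)).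
      rewrite lerXn2r ?nnegrE ?mulr_ge0 ?ler_wpM2l//; exact: sumr_ge0.
    rewrite (_ : (2 * _) ^+ 2 =
      16 * B ^+ 2 * ((l0norm psi)%:R * (l0norm psi)%:R)); last by ring.
    rewrite ler_wpM2l ?mulr_ge0 ?sqr_ge0// -!natrM ler_nat leq_mul//.
    by rewrite (leq_trans (max_card _))// card_ord.
  pose l := l1norm (fun a => b a - psi a).
  have lle : l <= 2 * l1norm psi.
    apply: (@le_trans _ _ (l1norm b + l1norm psi)).
      by rewrite /l /l1norm -big_split/=; apply: ler_sum => a _; exact: ler_normB.
    by rewrite mulrDl mul1r lerD2r.
  have l0 : 0 <= l by apply: sumr_ge0.
  have sql : \sum_(a < k.+1) (b a - psi a) ^+ 2 <= l ^+ 2.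
    rewrite expr2 {1}/l /l1norm mulr_suml; apply: ler_sum => a _.
    rewrite -real_normK ?num_real// expr2 ler_wpM2l//.
    by rewrite /l /l1norm (bigD1 a)//= lerDl sumr_ge0.
  apply: (@le_trans _ _ (C / k.+1%:R * (16 * B ^+ 2 * (s%:R * k.+1%:R)))).
    rewrite ler_wpM2l ?divr_ge0 ?(ltW C0)//.
    rewrite (le_trans sql)// (le_trans _ lpsi2)// lerXn2r// nnegrE.
    by rewrite (le_trans l0).
  rewrite (_ : _ * (_ * _) = C * (16 * B ^+ 2 * s%:R)); last first.
    by field; rewrite gt_eqF.
  rewrite -[leRHS]mulrA ler_wpM2l ?(ltW C0)//; apply: ler_pM => //.
  - by rewrite mulr_ge0// sqr_ge0.
  - by rewrite lerDl mulr_ge0// sqr_ge0.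
  - by rewrite ler_peMr// exprn_ege1.
have bs : (l0norm b <= s)%N.
  have [bne b00] := bsub.
  have [e|/set0P ne] := eqVneq (subset_argmin s risk) set0.
    rewrite /l0norm (_ : [set a | _]%SET = finset.set0) ?cards0//.
    by apply/setP => a; rewrite !inE b00// eqxx.
  by have [[]] := bne ne.
have Mn a : `|b a - psi a| <= M * n%:R.
  rewrite (le_trans (ler_normB _ _))//.
  apply: (@le_trans _ _ (2 * B ^+ 2 + 2 * B * n%:R + 2 * B)).
    by rewrite lerD// estimate_coordinate_bounded.
  have h1 : 2 * B ^+ 2 <= 2 * B ^+ 2 * n%:R by rewrite ler_peMr// mulr_ge0// sqr_ge0.
  have h2 : 2 * B <= 2 * B * n%:R by rewrite ler_peMr// mulr_ge0.
  by rewrite /M; lra.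
have sqle : \sum_(a < k.+1) (b a - psi a) ^+ 2 <= (2 * s)%:R * (M * n%:R) ^+ 2.
  pose S := [set a | b a - psi a != 0]%SET.
  have S2 : (#|S| <= 2 * s)%N.
    by rewrite mul2n -addnn (leq_trans (l0norm_sub b psi))// leq_add.
  have vS a : a \notin S -> b a - psi a = 0 by rewrite inE negbK => /eqP.
  rewrite (sum_support (f := fun x => x ^+ 2) (expr0n _ _) vS).
  apply: (@le_trans _ _ (\sum_(a in S) (M * n%:R) ^+ 2)).
    apply: ler_sum => a _; rewrite -real_normK ?num_real//.
    by rewrite lerXn2r// nnegrE (le_trans _ (Mn a)).
  by rewrite sumr_const -[leLHS]mulr_natl ler_wpM2r ?sqr_ge0// ler_nat.
apply: (@le_trans _ _ (C * ((2 * s)%:R * (M * n%:R) ^+ 2))).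
  apply: ler_pM => //; first by rewrite divr_ge0// ltW.
  by rewrite ler_pdivrMr// ler_peMr ?(ltW C0)// ler1n.
rewrite natrM exprMn.
rewrite (_ : C * _ = C * (2 * M ^+ 2) * (s%:R * n%:R ^+ 2)); last by ring.
rewrite ler_wpM2r// ler_wpM2l ?(ltW C0)// lerDr.
by apply: mulr_ge0 => //; exact: sqr_ge0.
Qed.

End EstimationError.

(** * Numerical bounds *)

Lemma ln_nat_ge_half (R : realType) (k : nat) : (2 <= k)%N -> 2^-1 <= ln (k%:R : R).
Proof.
move=> k2; have k0 : 0 < k%:R :> R by rewrite ltr0n (leq_trans _ k2).
rewrite -ler_expR lnK ?posrE//; apply: (@le_trans _ _ 2); last by rewrite ler_nat.
have := @expR_le_quadratic R 2^-1; rewrite ger0_norm ?invr_ge0// => /(_ (lexx _)).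
lra.
Qed.

(** With y = c n / (64 k) the sample size condition says 4 ln k <= y, so that
    n^3 k is a multiple of y^3 k^4 <= y^3 exp y, and one more exp y absorbs
    y^3. *)
Lemma exp_tail_le (R : realType) (c : R) (k n : nat) : 0 < c -> (2 <= k)%N ->
  256 / c * k%:R * ln k%:R <= n%:R ->
  n%:R ^+ 3 * k%:R * expR (- (c * n%:R / (32 * k%:R))) <=
  12 * (64 / c) ^+ 3 * ln k%:R.
Proof.
move=> c0 k2 kn; have k0 : 0 < k%:R :> R by rewrite ltr0n (leq_trans _ k2).
have l2 := ln_nat_ge_half R k2.
set l := ln k%:R in kn l2 *.
pose y : R := c * n%:R / (64 * k%:R).
have y0 : 0 <= y by apply: divr_ge0; apply: mulr_ge0 => //; exact: ltW.
have c64 : 0 < 64 / c by rewrite divr_gt0.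
have ly : 4 * l <= y.
  rewrite /y ler_pdivlMr ?mulr_gt0// (_ : 4 * l * _ = c * (256 / c * k%:R * l)).
    by rewrite ler_wpM2l// ltW.
  by field; rewrite gt_eqF.
have kE : k%:R = expR l by rewrite lnK ?posrE.
have y3 : y ^+ 3 <= 6 * expR y.
  have := expR_ge1Dxn 2 y0; rewrite (_ : 3`!%:R = 6 :> R)// => h.
  have : y ^+ 3 / 6 <= expR y by apply: le_trans h; rewrite lerDr.
  by rewrite ler_pdivrMr// mulrC.
have k4 : k%:R ^+ 4 <= expR y :> R by rewrite {1}kE -expRM_natl ler_expR.
rewrite (_ : c * n%:R / (32 * k%:R) = y + y); last first.
  by rewrite /y; field; rewrite gt_eqF.
rewrite (_ : n%:R ^+ 3 * k%:R = (64 / c) ^+ 3 * (y ^+ 3 * k%:R ^+ 4)); last first.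
  by rewrite /y; field; rewrite !gt_eqF.
apply: (@le_trans _ _ ((64 / c) ^+ 3 * (6 * expR y * expR y) * expR (- (y + y)))).
  rewrite ler_wpM2r ?expR_ge0// ler_wpM2l ?exprn_ge0 ?(ltW c64)//.
  by apply: ler_pM => //; rewrite exprn_ge0// ltW.
have -> : (64 / c) ^+ 3 * (6 * expR y * expR y) * expR (- (y + y)) =
    (64 / c) ^+ 3 * 6.
  by rewrite opprD expRD !expRN; field; rewrite !gt_eqF ?expR_gt0.
rewrite [leRHS]mulrAC [leRHS]mulrC ler_wpM2l ?exprn_ge0 ?(ltW c64)//; lra.
Qed.

Lemma scaled_sqr_le_exp_tail (R : realType) (l L eta k n S : R) :
  2^-1 <= l -> 0 <= L -> 0 < k -> 0 < n -> eta ^+ 2 = k * l / n ->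
  (S / n) ^+ 2 <= l / (k * n) *
    (L ^+ 2 + 32 * expR (- (l * L / 2)) * (expR (eta * S) + expR (- eta * S))).
Proof.
move=> l2 L0 k0 n0 eta2; have l0 : 0 < l by exact: lt_le_trans l2.
have := sqr_le_exp_tail (eta * S / l) l2 L0.
rewrite mulNr (_ : l * (eta * S / l) = eta * S); last by field; rewrite gt_eqF.
rewrite mulNr => h.
rewrite (_ : (S / n) ^+ 2 = l / (k * n) * (eta * S / l) ^+ 2).
  by rewrite ler_wpM2l// divr_ge0// ltW// mulr_gt0.
by rewrite !exprMn eta2; field; rewrite !gt_eqF.
Qed.

(** * The mean loss *)

Section RiskBound.
Context {R : realType} {d k n : nat}.
Local Notation obs := (observation R d k).
Context {dO : measure_display} {Omega : measurableType dO}.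
Variables (c C B : R).
Hypotheses (c0 : 0 < c) (C0 : 0 < C) (B0 : 0 < B).
Variables (Q : probability obs R) (mu pi : 'I_k.+1 -> covariate R d -> R).
Variables (psi0 : R) (psi : 'I_k.+1 -> R).
Variables (muhat pihat : estimator R d k n) (deltan epsn : R).
Variables (P : probability Omega R) (D1 D2 : {RV P >-> n.-tuple obs}).
Hypothesis condmu : is_cond_expectation Q (fun z => (cov z, trt z))
  (@outcome R d k) (fun u => mu u.2 u.1).
Hypothesis condpi : forall a, is_cond_expectation Q (@cov R d k)
  (fun z => (trt z == a)%:R) (pi a).
Hypothesis pi_gt0 : forall a, {ae Q, forall z, 0 < pi a (cov z)}.
Hypothesis effect_mean : forall a,
  ('E_Q[mu a \o cov] = (psi0 + psi a)%R%:E)%E.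
Hypothesis iid : independent_iid_samples P Q D1 D2.
Hypotheses (mmuhat : measurable_estimator muhat)
  (mpihat : measurable_estimator pihat).
Hypothesis prob_bounds : forall a,
  c / k.+1%:R <= treatment_prob Q a <= C / k.+1%:R.
Hypothesis weight_bounded : forall a, {ae P, forall w, {ae Q, forall z,
  `|treatment_freq (D1 w) a / pihat a (D1 w) (cov z)| <= B}}.
Hypothesis muhat_bounded : forall a, {ae P, forall w, {ae Q, forall z,
  `|muhat a (D1 w) (cov z)| <= B}}.
Hypothesis outcome_bounded : {ae Q, forall z, `|outcome z| <= B}.
Hypothesis psi0_bounded : `|psi0| <= B.
Hypothesis propensity_error : forall a, {ae P, forall w,
  (L2norm Q (fun x => pi a x / pihat a (D1 w) x - 1)%R <= deltan%:E)%E}.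
Hypothesis regression_error : forall a, {ae P, forall w,
  (L2norm Q (fun x => mu a x - muhat a (D1 w) x)%R <= epsn%:E)%E}.

Definition sample_score a (t : n.-tuple obs) (z : obs) : R :=
  score psi0 psi a (treatment_freq t a) (muhat a t) (pihat a t) z.

(** The weights wh of the score come from D1; on this event they
    are of the order of 1 / k. *)
Definition small_freq a (t : n.-tuple obs) : bool :=
  treatment_freq t a <= 2 * treatment_prob Q a.

Definition score_dev a := deviation Q D1 D2 (small_freq a) (sample_score a).
Definition freq1_dev a :=
  deviation Q D2 D1 (fun=> true) (fun _ => @treated R d k a).
Definition freq2_dev a :=
  deviation Q D1 D2 (fun=> true) (fun _ => @treated R d k a).

Lemma measurable_sample_score a :
  measurable_fun [set: (n.-tuple obs * obs)%type]
    (fun u => sample_score a u.1 u.2).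
Proof.
have mm := measurable_estimator_eval a mmuhat.
have mp := measurable_estimator_eval a mpihat.
have mt : measurable_fun [set: (n.-tuple obs * obs)%type]
    (fun u : (n.-tuple obs * obs)%type => treated a u.2 : R).
  exact: (measurableT_comp (measurable_treated a) measurable_snd).
have my : measurable_fun [set: (n.-tuple obs * obs)%type]
    (fun u : (n.-tuple obs * obs)%type => outcome u.2).
  exact: (measurableT_comp measurable_outcome measurable_snd).
have mw : measurable_fun [set: (n.-tuple obs * obs)%type]
    (fun u : (n.-tuple obs * obs)%type => treatment_freq u.1 a).
  exact: (measurableT_comp (measurable_treatment_freq a) measurable_fst).
rewrite /sample_score /score.
apply: measurable_funB; last first.
  by apply: measurable_funM; [exact: mt|exact: measurable_cst].
apply: measurable_funM => //.
apply: measurable_funB; last exact: measurable_cst.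
apply: measurable_funD => //.
apply: measurable_funM; last exact: measurable_funB.
apply: measurable_funM => //; exact: (measurableT_comp (@measurable_inv R) mp).
Qed.

Lemma measurable_treated_snd a :
  measurable_fun [set: (n.-tuple obs * obs)%type]
    (fun u : (n.-tuple obs * obs)%type => treated a u.2 : R).
Proof. exact: (measurableT_comp (measurable_treated a) measurable_snd). Qed.

Lemma measurable_small_freq a :
  measurable_fun [set: n.-tuple obs] (small_freq a).
Proof.
apply: measurable_fun_ler; first exact: measurable_treatment_freq.
exact: measurable_cst.
Qed.

Lemma prob_ge0 a : 0 <= treatment_prob Q a.
Proof.
have /andP[+ _] := prob_bounds a; apply: le_trans.
by rewrite divr_ge0// ltW.
Qed.

Lemma score_dev_mean a (eta : R) :
  `|eta| * (2 * B ^+ 2 + 4 * B) <= 2^-1 ->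
  dominated_mean P (fun w => expR (eta * score_dev a w))
    (expR (n%:R * (2 * eta ^+ 2 *
      (C * (2 * (2 * B ^+ 2 + 2 * B) ^+ 2 + 16 * B ^+ 2 + 1) / k.+1%:R)))).
Proof.
move=> etaM; have /andP[_ pC] := prob_bounds a; have B0' := ltW B0.
apply: (exp_deviation_mean _ _ iid _ _ etaM) => //.
- exact: measurable_small_freq.
- exact: measurable_sample_score.
- by rewrite divr_ge0// mulr_ge0 ?(ltW C0)// !addr_ge0// mulr_ge0// sqr_ge0.
apply: filterS2 (weight_bounded a) (muhat_bounded a) => w wB mB kp.
have mmh : measurable_fun [set: covariate R d] (muhat a (D1 w)).
  exact: (measurable_fun_pair2 (D1 w) (mmuhat a)).
have mph : measurable_fun [set: covariate R d] (pihat a (D1 w)).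
  exact: (measurable_fun_pair2 (D1 w) (mpihat a)).
have w0 := treatment_freq_ge0 (D1 w) a.
have w1 := treatment_freq_le1 (D1 w) a.
split.
  exact: (ae_score_bounded condmu condpi pi_gt0 outcome_bounded effect_mean).
apply: le_trans (score_second_moment condmu condpi pi_gt0 outcome_bounded
  effect_mean psi0_bounded a w0 w1 mmh mph wB mB) _.
set V1 := 2 * (2 * B ^+ 2 + 2 * B) ^+ 2.
have V10 : 0 <= V1 by rewrite mulr_ge0// sqr_ge0.
have B2 : 0 <= 8 * B ^+ 2 by rewrite mulr_ge0// sqr_ge0.
have h1 : 8 * B ^+ 2 * treatment_freq (D1 w) a <=
    8 * B ^+ 2 * (2 * treatment_prob Q a) by rewrite ler_wpM2l.
have h2 : (V1 + 16 * B ^+ 2 + 1) * treatment_prob Q a <=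
    (V1 + 16 * B ^+ 2 + 1) * (C / k.+1%:R).
  by rewrite ler_wpM2l// !addr_ge0// mulr_ge0// sqr_ge0.
rewrite (_ : C * _ / _ = (V1 + 16 * B ^+ 2 + 1) * (C / k.+1%:R)); last first.
  by rewrite mulrAC mulrC.
apply: le_trans h2; have := prob_ge0 a.
move: h1; rewrite !mulrDl; lra.
Qed.

Lemma treated_dev_mean (E1 E2 : {RV P >-> n.-tuple obs}) a (eta : R) :
  independent_iid_samples P Q E1 E2 -> `|eta| <= 2^-1 ->
  dominated_mean P
    (fun w => expR (eta * deviation Q E1 E2 (fun=> true)
                            (fun _ => @treated R d k a) w))
    (expR (n%:R * (2 * eta ^+ 2 * treatment_prob Q a))).
Proof.
move=> iidE eta2.
apply: (@exp_deviation_mean _ _ _ _ _ _ _ _ _ _ _ _ iidE _ _ _ _ 1) => //.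
- exact: measurable_treated_snd.
- by rewrite mulr1.
- exact: prob_ge0.
apply: nearW => w _; split.
  by apply: nearW => z; exact: treated_le1.
rewrite -Rintegral_treated le_eqVlt; apply/orP; left; apply/eqP.
apply: eq_Rintegral => z _.
by rewrite /treated; case: (_ == _); rewrite /= ?expr1n ?expr0n.
Qed.

Lemma treated_devE (E1 E2 : Omega -> n.-tuple obs) a w : (0 < n)%N ->
  deviation Q E1 E2 (fun=> true) (fun _ => @treated R d k a) w / n%:R =
  treatment_freq (E2 w) a - treatment_prob Q a.
Proof.
move=> n0; rewrite /deviation sumrB Rintegral_treated sumr_const card_ord.
rewrite /treatment_freq /sample_mean -[treatment_prob Q a *+ n]mulr_natr.
by rewrite mulrBl mulfK ?pnatr_eq0 ?gtn_eqF// mulrC.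
Qed.

Lemma L2_errors_ge0 : 0 <= deltan * epsn.
Proof.
have PF : ProperFilter (almost_everywhere P).
  apply: ae_properfilter_algebraOfSetsType.
  by rewrite [ltRHS]probability_setT.
have hd : 0 <= deltan.
  have [w h] := @filter_ex _ _ PF _ (propensity_error ord0).
  by rewrite -lee_fin (le_trans _ h)// Lnorm_ge0.
have he : 0 <= epsn.
  have [w h] := @filter_ex _ _ PF _ (regression_error ord0).
  by rewrite -lee_fin (le_trans _ h)// Lnorm_ge0.
exact: mulr_ge0.
Qed.

(** The gradient of the risk at psi is its deviation from its conditional mean
    given D1, plus that mean, which consists of the product of the estimation
    errors and of the deviation of the frequency in D1. *)
Lemma ae_residual_sqr_le : (0 < n)%N ->
  {ae P, forall w, forall a, small_freq a (D1 w) ->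
    (weighted_effect psi0 muhat pihat (D1 w) (D2 w) a
      - treatment_freq (D2 w) a * psi a) ^+ 2 <=
    3 * (score_dev a w / n%:R) ^+ 2 + 12 * (C / k.+1%:R * (deltan * epsn)) ^+ 2
    + 12 * B ^+ 2 * (freq1_dev a w / n%:R) ^+ 2}.
Proof.
move=> n0; have n0' : 0 < n%:R :> R by rewrite ltr0n.
have de0 := L2_errors_ge0.
apply: filter_forall => a.
near=> w => kp.
have w0 := treatment_freq_ge0 (D1 w) a.
have w1 := treatment_freq_le1 (D1 w) a.
have mmh : measurable_fun [set: covariate R d] (muhat a (D1 w)).
  exact: (measurable_fun_pair2 (D1 w) (mmuhat a)).
have mph : measurable_fun [set: covariate R d] (pihat a (D1 w)).
  exact: (measurable_fun_pair2 (D1 w) (mpihat a)).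
have mb : `|\int[Q]_z sample_score a (D1 w) z| <=
    treatment_freq (D1 w) a * (deltan * epsn)
    + 2 * B * `|treatment_freq (D1 w) a - treatment_prob Q a|.
  apply: (score_mean_bound condmu condpi pi_gt0 outcome_bounded effect_mean
    psi0_bounded w0 w1 mmh mph).
  - by near: w; exact: weight_bounded.
  - by near: w; exact: muhat_bounded.
  - by near: w; exact: propensity_error.
  - by near: w; exact: regression_error.
rewrite weighted_effect_residual -(treated_devE D2 D1) // in mb *.
have -> : sample_mean (D2 w) (score psi0 psi a (treatment_freq (D1 w) a)
    (muhat a (D1 w)) (pihat a (D1 w))) =
    score_dev a w / n%:R + \int[Q]_z sample_score a (D1 w) z.
  rewrite /score_dev /deviation kp sumrB sumr_const card_ord mulrBl.
  rewrite -[X in _ - X / _]mulr_natr mulfK ?pnatr_eq0 ?gtn_eqF// subrK.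
  by rewrite /sample_mean mulrC.
have fp : treatment_freq (D1 w) a <= 2 * (C / k.+1%:R).
  by apply: le_trans kp _; rewrite ler_wpM2l//; have /andP[] := prob_bounds a.
have {}mb : `|\int[Q]_z sample_score a (D1 w) z| <=
    2 * (C / k.+1%:R * (deltan * epsn)) + 2 * B * `|freq1_dev a w / n%:R|.
  apply: le_trans mb _; by rewrite lerD2r [leRHS]mulrA ler_wpM2r.
rewrite -[leLHS]real_normK ?num_real//.
set X := score_dev a w / n%:R; set Y := C / k.+1%:R * (deltan * epsn).
set Z := freq1_dev a w / n%:R in mb *.
have Y0 : 0 <= Y by rewrite mulr_ge0// divr_ge0// ltW.
have hX : `|X + \int[Q]_z sample_score a (D1 w) z| <= `|X| + 2 * Y + 2 * B * `|Z|.
  by rewrite (le_trans (ler_normD _ _))// -addrA lerD2l.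
apply: (@le_trans _ _ ((`|X| + 2 * Y + 2 * B * `|Z|) ^+ 2)).
  by rewrite lerXn2r// nnegrE// (le_trans _ hX).
rewrite -(real_normK (num_real X)) -(real_normK (num_real Z)).
rewrite -subr_ge0 (_ : _ - _ = (`|X| - 2 * Y) ^+ 2 + (`|X| - 2 * B * `|Z|) ^+ 2
  + (2 * Y - 2 * B * `|Z|) ^+ 2); last by ring.
by rewrite !addr_ge0// sqr_ge0.
Unshelve. all: by end_near. Qed.

Local Notation M := (2 * B ^+ 2 + 4 * B).
Local Notation V := (C * (2 * (2 * B ^+ 2 + 2 * B) ^+ 2 + 16 * B ^+ 2 + 1)).
Local Notation L := (2 * (1 + 2 * V)).
Local Notation lnk := (ln k.+1%:R : R).
Hypothesis k_ge2 : (2 <= k.+1)%N.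
Hypothesis sample_size :
  (4 * M ^+ 2 + 4 + 256 / c) * k.+1%:R * lnk <= n%:R.

Let k0 : 0 < k.+1%:R :> R.
Proof. by rewrite ltr0n. Qed.

Let lnk2 : 2^-1 <= lnk.
Proof. exact: ln_nat_ge_half. Qed.

Let lnk0 : 0 < lnk.
Proof. exact: lt_le_trans lnk2. Qed.

Let gamma0 : 0 < 4 * M ^+ 2 + 4 + 256 / c.
Proof.
have c256 : 0 < 256 / c by rewrite divr_gt0 ?ltr0n.
by have M20 := sqr_ge0 M; lra.
Qed.

Let n0 : (0 < n)%N.
Proof.
rewrite -(ltr0n R); apply: lt_le_trans sample_size.
by rewrite !mulr_gt0.
Qed.

Let n0' : 0 < n%:R :> R.
Proof. by rewrite ltr0n. Qed.

Let V0 : 0 <= V.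
Proof.
by rewrite mulr_ge0 ?(ltW C0)// !addr_ge0// mulr_ge0// sqr_ge0.
Qed.

(** The exponent eta of the exponential moments is chosen so that n eta^2 times
    the variance of order 1 / k is of order ln k, while eta stays below the
    inverse of the bounds thanks to n >= gamma k ln k.  Correspondingly eta n
    times a deviation of order sqrt (ln k / (k n)) is of order ln k. *)
Definition tail_scale : R := Num.sqrt (k.+1%:R * lnk / n%:R).
Local Notation eta := tail_scale.

Lemma tail_scale_sqr : eta ^+ 2 = k.+1%:R * lnk / n%:R.
Proof. by rewrite sqr_sqrtr// divr_ge0// mulr_ge0// ltW. Qed.

Lemma tail_scale_small (x : R) : 0 <= x ->
  4 * x ^+ 2 * k.+1%:R * lnk <= n%:R -> eta * x <= 2^-1.
Proof.
move=> x0 xn; have e0 : 0 <= eta by exact: sqrtr_ge0.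
rewrite -(@ler_pXn2r _ 2)// ?nnegrE ?mulr_ge0//.
rewrite exprMn tail_scale_sqr mulrAC ler_pdivrMr//; lra.
Qed.

Let etaM : `|eta| * M <= 2^-1.
Proof.
rewrite ger0_norm ?sqrtr_ge0//; apply: tail_scale_small.
  by rewrite addr_ge0 ?mulr_ge0 ?sqr_ge0// ltW.
apply: le_trans sample_size; rewrite ler_wpM2r ?(ltW lnk0)// ler_wpM2r ?(ltW k0)//.
have c256 : 0 < 256 / c by rewrite divr_gt0 ?ltr0n.
lra.
Qed.

Let eta1 : `|eta| <= 2^-1.
Proof.
rewrite ger0_norm ?sqrtr_ge0// -[eta]mulr1; apply: tail_scale_small => //.
apply: le_trans sample_size; rewrite ler_wpM2r ?(ltW lnk0)// ler_wpM2r ?(ltW k0)//.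
have c256 : 0 < 256 / c by rewrite divr_gt0 ?ltr0n.
have M20 := sqr_ge0 M; lra.
Qed.

Definition exp_tails (X : 'I_k.+1 -> Omega -> R) (w : Omega) : R :=
  \sum_(a < k.+1) (expR (eta * X a w) + expR (- eta * X a w)).

Lemma exp_tails_mean X :
  (forall a e, `|e| = `|eta| -> dominated_mean P (fun w => expR (e * X a w))
      (expR (n%:R * (2 * e ^+ 2 * (V / k.+1%:R))))) ->
  dominated_mean P (exp_tails X) (k.+1%:R * (2 * expR (2 * lnk * V))).
Proof.
move=> hX; rewrite -[X in dominated_mean _ _ (X%:R * _)]card_ord.
apply: dominated_mean_sum => a; rewrite mulrDl mul1r.
have eE e : e ^+ 2 = eta ^+ 2 ->
    n%:R * (2 * e ^+ 2 * (V / k.+1%:R)) = 2 * lnk * V.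
  by move=> ->; rewrite tail_scale_sqr; field; rewrite !gt_eqF.
apply: dominated_meanD; rewrite -(@eE eta)//; first exact: hX.
by rewrite -(sqrrN eta); apply: hX; rewrite normrN.
Qed.

Lemma score_tails_mean :
  dominated_mean P (exp_tails score_dev) (k.+1%:R * (2 * expR (2 * lnk * V))).
Proof.
by apply: exp_tails_mean => a e ee; apply: score_dev_mean; rewrite ee.
Qed.

Lemma freq_tails_mean :
  dominated_mean P (exp_tails freq1_dev) (k.+1%:R * (2 * expR (2 * lnk * V))).
Proof.
apply: exp_tails_mean => a e ee.
have e1 : `|e| <= 2^-1 by rewrite ee.
apply: (dominated_mean_le _ (treated_dev_mean a (iid_samples_swap iid) e1)).
rewrite ler_expR ler_wpM2l//; apply: ler_wpM2l.
  by apply: mulr_ge0 => //; exact: sqr_ge0.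
have /andP[_ pC] := prob_bounds a; apply: (le_trans pC).
rewrite ler_wpM2r ?invr_ge0// ler_peMr ?(ltW C0)// lerDr addr_ge0//.
  by rewrite mulr_ge0// sqr_ge0.
by rewrite mulr_ge0// sqr_ge0.
Qed.

(** An exponential substitute for the indicator of the event that some
    treatment is too rare in D2 or too frequent in D1: it is at least 1 there,
    and its mean is exponentially small in n / k. *)
Definition imbalance (w : Omega) : R :=
  \sum_(a < k.+1)
    (expR (- (n%:R * treatment_prob Q a / 16)) * expR (- 8^-1 * freq2_dev a w)
     + expR (- (n%:R * treatment_prob Q a / 8)) * expR (8^-1 * freq1_dev a w)).

Lemma imbalance_mean : dominated_mean P imbalance
  (k.+1%:R * (2 * expR (- (c * n%:R / (32 * k.+1%:R))))).
Proof.
rewrite -[X in dominated_mean _ _ (X%:R * _)]card_ord.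
apply: dominated_mean_sum => a; rewrite mulrDl mul1r.
have e8 : `|8^-1| <= 2^-1 :> R by rewrite ger0_norm//; lra.
have e8' : `|- 8^-1| <= 2^-1 :> R by rewrite normrN.
have /andP[pc _] := prob_bounds a.
have np : c * n%:R / (32 * k.+1%:R) <= n%:R * treatment_prob Q a / 32.
  rewrite (_ : c * _ / _ = n%:R * (c / k.+1%:R) / 32); last first.
    by field; rewrite gt_eqF.
  by rewrite ler_wpM2r// ler_wpM2l.
have np0 : 0 <= n%:R * treatment_prob Q a by rewrite mulr_ge0// prob_ge0.
(* The moment exponent n p / 32 takes up at most half of the decay. *)
have eighth : n%:R * (2 * 8^-1 ^+ 2 * treatment_prob Q a) =
    n%:R * treatment_prob Q a / 32 by field.
apply: dominated_meanD.
- apply: dominated_mean_le; last first.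
    by apply: dominated_meanZ (treated_dev_mean a iid e8'); exact: expR_ge0.
  rewrite -expRD ler_expR sqrrN eighth.
  by move: np np0; set x := c * _ / _; set y := n%:R * _ => ? ?; lra.
- apply: dominated_mean_le; last first.
    apply: dominated_meanZ (treated_dev_mean a (iid_samples_swap iid) e8).
    exact: expR_ge0.
  rewrite -expRD ler_expR eighth.
  by move: np np0; set x := c * _ / _; set y := n%:R * _ => ? ?; lra.
Qed.

Lemma imbalance_ge1 w a :
  treatment_freq (D2 w) a < treatment_prob Q a / 2 \/ ~~ small_freq a (D1 w) ->
  1 <= imbalance w.
Proof.
move=> h.
have np0 : 0 <= n%:R * treatment_prob Q a by rewrite mulr_ge0// prob_ge0.
rewrite /imbalance (bigD1 a)//= -[leLHS]addr0; apply: lerD; last first.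
  by apply: sumr_ge0 => b _; rewrite addr_ge0// ?mulr_ge0 ?expR_ge0.
rewrite -!expRD; case: h => [h|].
  have : freq2_dev a w / n%:R <= - (treatment_prob Q a / 2).
    by rewrite treated_devE//; lra.
  rewrite ler_pdivrMr// => h2.
  rewrite -[leLHS]addr0; apply: lerD; last exact: expR_ge0.
  by rewrite -[leLHS]expR0 ler_expR; lra.
rewrite -ltNge => h.
have : treatment_prob Q a <= freq1_dev a w / n%:R.
  by rewrite treated_devE//; lra.
rewrite ler_pdivlMr// => h2.
rewrite -[leLHS]add0r; apply: lerD; first exact: expR_ge0.
by rewrite -[leLHS]expR0 ler_expR; lra.
Qed.

Variables (s : nat) (psihat : Omega -> 'I_k.+1 -> R).
Hypothesis psi_sparse : (l0norm psi <= s)%N.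
Hypothesis psihat_estimates : {ae P, forall w,
  lasso_argmin (l1norm psi)
    (empirical_risk psi0 muhat pihat (D1 w) (D2 w)) (psihat w) \/
  is_subset_estimate s (D2 w)
    (empirical_risk psi0 muhat pihat (D1 w) (D2 w)) (psihat w)}.

Let variance : R := lnk / (k.+1%:R * n%:R).
Let damping : R := 32 * expR (- (lnk * L / 2)).

Definition residual_bound (w : Omega) : R :=
  3 * (variance * (L ^+ 2 + damping * exp_tails score_dev w))
  + 12 * (C / k.+1%:R * (deltan * epsn)) ^+ 2
  + 12 * B ^+ 2 * (variance * (L ^+ 2 + damping * exp_tails freq1_dev w)).

(** The first term bounds the loss on balanced samples; off them imbalance w
    is at least 1 and the second term is the crude bound. *)
Definition loss_bound (w : Omega) : R :=
  64 * C / c ^+ 2 * (k.+1%:R * s%:R * residual_bound w)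
  + C * (16 * B ^+ 2 + 2 * M ^+ 2) * (s%:R * n%:R ^+ 2) * imbalance w.

Let variance0 : 0 <= variance.
Proof. by rewrite divr_ge0 ?mulr_ge0// ltW. Qed.

Let damping0 : 0 <= damping.
Proof. by rewrite mulr_ge0// expR_ge0. Qed.

Let L0 : 0 <= L.
Proof. by rewrite mulr_ge0// addr_ge0// mulr_ge0. Qed.

Lemma sqr_dev_le_tails X a w :
  (X a w / n%:R) ^+ 2 <= variance * (L ^+ 2 + damping * exp_tails X w).
Proof.
apply: le_trans (scaled_sqr_le_exp_tail (X a w) lnk2 L0 k0 n0' tail_scale_sqr) _.
apply: ler_wpM2l => //; rewrite lerD2l; apply: ler_wpM2l => //.
rewrite /exp_tails (bigD1 a)//= lerDl; apply: sumr_ge0 => i _.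
by rewrite addr_ge0// expR_ge0.
Qed.

Lemma residual_bound_ge0 w : 0 <= residual_bound w.
Proof.
have h X := le_trans (sqr_ge0 _) (sqr_dev_le_tails X ord0 w).
have B2 := sqr_ge0 B.
by rewrite !addr_ge0// mulr_ge0// ?sqr_ge0// mulr_ge0.
Qed.

Lemma ae_loss_le_bound : {ae P, forall w,
  \sum_(a < k.+1) treatment_prob Q a * (psihat w a - psi a) ^+ 2 <=
  loss_bound w}.
Proof.
have psiB a : `|psi a| <= 2 * B.
  exact: (effect_bounded condmu condpi pi_gt0 outcome_bounded effect_mean).
have mW a : measurable_fun [set: (n.-tuple obs * obs)%type]
    (fun u : (n.-tuple obs * obs)%type =>
       treatment_freq u.1 a / pihat a u.1 (cov u.2)).
  have mp := measurable_estimator_eval a mpihat.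
  apply: measurable_funM; last exact: (measurableT_comp (@measurable_inv R) mp).
  exact: (measurableT_comp (measurable_treatment_freq a) measurable_fst).
have mYo : measurable_fun [set: (n.-tuple obs * obs)%type]
    (fun u : (n.-tuple obs * obs)%type => outcome u.2).
  exact: (measurableT_comp measurable_outcome measurable_snd).
have mD1 : measurable_fun [set: Omega] D1 by [].
have mD2 : measurable_fun [set: Omega] D2 by [].
have aeW : {ae P, forall w, forall a i,
    `|treatment_freq (D1 w) a / pihat a (D1 w) (cov (tnth (D2 w) i))| <= B}.
  apply: filter_forall => a.
  exact: (ae_sample2 (f := fun t z => treatment_freq t a / pihat a t (cov z))
    mD1 mD2 iid (mW a) (weight_bounded a)).
have aeM : {ae P, forall w, forall a i,
    `|muhat a (D1 w) (cov (tnth (D2 w) i))| <= B}.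
  apply: filter_forall => a.
  exact: (ae_sample2 (f := fun t z => muhat a t (cov z))
    mD1 mD2 iid (measurable_estimator_eval a mmuhat) (muhat_bounded a)).
have aeY : {ae P, forall w, forall i, `|outcome (tnth (D2 w) i)| <= B}.
  apply: (ae_sample2 (f := fun _ z => outcome z) mD1 mD2 iid mYo).
  by apply: nearW => w; exact: outcome_bounded.
have imb0 w : 0 <= imbalance w.
  by apply: sumr_ge0 => a _; rewrite addr_ge0// mulr_ge0// expR_ge0.
near=> w.
have est : lasso_argmin (l1norm psi)
    (empirical_risk psi0 muhat pihat (D1 w) (D2 w)) (psihat w) \/
  is_subset_estimate s (D2 w)
    (empirical_risk psi0 muhat pihat (D1 w) (D2 w)) (psihat w) by near: w.
have crude : \sum_(a < k.+1) treatment_prob Q a * (psihat w a - psi a) ^+ 2 <=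
    C * (16 * B ^+ 2 + 2 * M ^+ 2) * (s%:R * n%:R ^+ 2).
  apply: (loss_le_crude C0 B0 prob_bounds psi_sparse est psiB _ psi0_bounded) => //.
  - by near: w.
  - by near: w.
  - by near: w.
have crude0 : 0 <= C * (16 * B ^+ 2 + 2 * M ^+ 2) * (s%:R * n%:R ^+ 2).
  apply: le_trans crude; apply: sumr_ge0 => a _.
  by rewrite mulr_ge0 ?prob_ge0// sqr_ge0.
have lead0 : 0 <= 64 * C / c ^+ 2 * (k.+1%:R * s%:R * residual_bound w).
  have r0 := residual_bound_ge0 w.
  by apply: mulr_ge0; [rewrite divr_ge0 ?mulr_ge0 ?exprn_ge0// ltW|rewrite !mulr_ge0].
have [bal|] := pselect (forall a, treatment_prob Q a / 2 <= treatment_freq (D2 w) a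
    /\ small_freq a (D1 w)).
  rewrite -[leLHS]addr0; apply: lerD; last exact: mulr_ge0.
  apply: (loss_le_balanced c0 C0 prob_bounds psi_sparse est) => a.
    by have [] := bal a.
  have [_ sf] := bal a.
  have res : forall a, small_freq a (D1 w) ->
    (weighted_effect psi0 muhat pihat (D1 w) (D2 w) a
      - treatment_freq (D2 w) a * psi a) ^+ 2 <=
    3 * (score_dev a w / n%:R) ^+ 2 + 12 * (C / k.+1%:R * (deltan * epsn)) ^+ 2
    + 12 * B ^+ 2 * (freq1_dev a w / n%:R) ^+ 2.
    by near: w; exact: ae_residual_sqr_le.
  apply: le_trans (res a sf) _; apply: lerD; last first.
    apply: ler_wpM2l; last exact: sqr_dev_le_tails.
    by rewrite mulr_ge0// sqr_ge0.
  by rewrite lerD2r; apply: ler_wpM2l => //; exact: sqr_dev_le_tails.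
move=> /existsNP[a /not_andP unbal].
have imb1 : 1 <= imbalance w.
  apply: (imbalance_ge1 (a := a)); case: unbal => /negP; [left|by right].
  by rewrite ltNge.
apply: le_trans crude _; rewrite -[leLHS]add0r; apply: lerD => //.
by rewrite -[leLHS]mulr1; apply: ler_wpM2l.
Unshelve. all: by end_near. Qed.

Definition rate_constant : R :=
  64 * C / c ^+ 2 * ((3 + 12 * B ^+ 2) * (L ^+ 2 + 64))
  + 768 * C ^+ 3 / c ^+ 2
  + 24 * (C * (16 * B ^+ 2 + 2 * M ^+ 2)) * (64 / c) ^+ 3.

Lemma rate_constant_gt0 : 0 < rate_constant.
Proof.
rewrite /rate_constant; set l2 := L ^+ 2; set m2 := M ^+ 2.
have l20 : 0 <= l2 by exact: sqr_ge0.
have m20 : 0 <= m2 by exact: sqr_ge0.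
have b20 : 0 <= B ^+ 2 by exact: sqr_ge0.
have cV0 : 0 < c ^+ 2 by exact: exprn_gt0.
have c64 : 0 < (64 / c) ^+ 3 by apply: exprn_gt0; rewrite divr_gt0 ?ltr0n.
apply: ltr_wpDr.
  apply: mulr_ge0; last exact: ltW.
  apply: mulr_ge0; first by rewrite ler0n.
  by apply: mulr_ge0; [exact: ltW|lra].
apply: ltr_wpDr.
  apply: divr_ge0; last exact: ltW.
  by apply: mulr_ge0; [rewrite ler0n|apply: exprn_ge0; exact: ltW].
apply: mulr_gt0; first by apply: divr_gt0 => //; rewrite mulr_gt0 ?ltr0n.
by apply: mulr_gt0; lra.
Qed.

(** L is chosen so that damping times the bound on the mean of the
    exponential tails is the constant 64.  The mean of the imbalance,
    multiplied by the crude bound of order s n^2, remains of order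
    s ln k / n. *)
Lemma loss_bound_mean : dominated_mean P loss_bound
  (rate_constant * (s%:R * (lnk / n%:R) + s%:R / k.+1%:R * (deltan * epsn) ^+ 2)).
Proof.
have B2 := sqr_ge0 B.
have tails X : dominated_mean P (exp_tails X) (k.+1%:R * (2 * expR (2 * lnk * V))) ->
    dominated_mean P (fun w => variance * (L ^+ 2 + damping * exp_tails X w))
      (variance * (L ^+ 2 + 64)).
  move=> hX; have -> : 64 = damping * (k.+1%:R * (2 * expR (2 * lnk * V))).
    rewrite /damping (_ : - (lnk * L / 2) = - lnk + - (2 * lnk * V)); last by field.
    rewrite expRD !expRN lnK ?posrE//.
    by field; rewrite !gt_eqF// expR_gt0.
  apply: dominated_meanZ => //; apply: dominated_meanD.
    by apply: dominated_mean_cst; exact: sqr_ge0.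
  exact: dominated_meanZ.
have K20 : 0 <= C * (16 * B ^+ 2 + 2 * M ^+ 2) * (s%:R * n%:R ^+ 2).
  apply: mulr_ge0; last by apply: mulr_ge0 => //; exact: sqr_ge0.
  apply: mulr_ge0; first exact: ltW.
  by apply: addr_ge0; apply: mulr_ge0 => //; exact: sqr_ge0.
apply: dominated_mean_le; last first.
  apply: dominated_meanD.
    apply: dominated_meanZ; first by rewrite divr_ge0 ?mulr_ge0 ?exprn_ge0// ltW.
    apply: dominated_meanZ; first by rewrite mulr_ge0.
    apply: dominated_meanD; last first.
      by apply: dominated_meanZ (tails _ freq_tails_mean); rewrite mulr_ge0.
    apply: dominated_meanD; last first.
      by apply: dominated_mean_cst; rewrite mulr_ge0// sqr_ge0.
    by apply: dominated_meanZ (tails _ score_tails_mean).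
  exact: dominated_meanZ imbalance_mean.
have tail : n%:R ^+ 3 * k.+1%:R * expR (- (c * n%:R / (32 * k.+1%:R))) <=
    12 * (64 / c) ^+ 3 * lnk.
  apply: exp_tail_le => //; apply: le_trans sample_size.
  rewrite ler_wpM2r ?(ltW lnk0)// ler_wpM2r ?(ltW k0)// lerDr addr_ge0//.
  by rewrite mulr_ge0// sqr_ge0.
set r1 := 64 * C / c ^+ 2 * ((3 + 12 * B ^+ 2) * (L ^+ 2 + 64)).
set r2 := 768 * C ^+ 3 / c ^+ 2.
set K2 := C * (16 * B ^+ 2 + 2 * M ^+ 2) in K20 *.
pose r3 := 24 * K2 * (64 / c) ^+ 3.
set X := s%:R * (lnk / n%:R); set Y := s%:R / k.+1%:R * (deltan * epsn) ^+ 2.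
have K2_ge0 : 0 <= K2.
  apply: mulr_ge0; first exact: ltW.
  by apply: addr_ge0; apply: mulr_ge0 => //; exact: sqr_ge0.
have X0 : 0 <= X by apply: mulr_ge0 => //; apply: divr_ge0 => //; exact: ltW.
have Y0 : 0 <= Y.
  by apply: mulr_ge0; [exact: divr_ge0|exact: sqr_ge0].
have c20 : 0 < c ^+ 2 by exact: exprn_gt0.
have r10 : 0 <= r1.
  apply: mulr_ge0; first by apply: divr_ge0 => //; [apply: mulr_ge0 => //|]; exact: ltW.
  apply: mulr_ge0; apply: addr_ge0 => //; last exact: sqr_ge0.
  exact: mulr_ge0.
have r20 : 0 <= r2.
  apply: divr_ge0; last exact: ltW.
  by apply: mulr_ge0; [rewrite ler0n|apply: exprn_ge0; exact: ltW].
have r30 : 0 <= r3.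
  apply: mulr_ge0; first exact: mulr_ge0.
  by apply: exprn_ge0; apply: divr_ge0 => //; exact: ltW.
apply: (@le_trans _ _ (r1 * X + r2 * Y + r3 * X)); last first.
  rewrite (_ : rate_constant = r1 + r2 + r3)//.
  have := mulr_ge0 r10 Y0; have := mulr_ge0 r20 X0; have := mulr_ge0 r30 Y0.
  by rewrite !mulrDl !mulrDr; lra.
apply: lerD.
  rewrite le_eqVlt; apply/orP; left; apply/eqP.
  rewrite /r1 /r2 /X /Y /variance; field.
  by rewrite !gt_eqF.
rewrite (_ : K2 * _ * _ = 2 * K2 * s%:R / n%:R *
    (n%:R ^+ 3 * k.+1%:R * expR (- (c * n%:R / (32 * k.+1%:R))))); last first.
  by set e := expR _; field; rewrite gt_eqF.
rewrite (_ : r3 * X = 2 * K2 * s%:R / n%:R * (12 * (64 / c) ^+ 3 * lnk)).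
  apply: ler_wpM2l => //; apply: divr_ge0 => //.
  by apply: mulr_ge0 => //; exact: mulr_ge0.
by rewrite /r3 /X; field; rewrite !gt_eqF.
Qed.

End RiskBound.

Theorem theorem1 (R : realType) (c C B : R) (hc : 0 < c) (hC : 0 < C)
    (hB : 0 < B) :
  exists gamma K : R, [/\ 0 < gamma, 0 < K &
  forall (k' n s d : nat), let k := k'.+1 in
  forall (Q : probability (observation R d k') R)
    (mu pi : 'I_k -> covariate R d -> R) (psi0 : R) (psi : 'I_k -> R)
    (muhat pihat : estimator R d k' n) (deltan epsn : R)
    (dO : measure_display) (Omega : measurableType dO)
    (P : probability Omega R)
    (D1 D2 : {RV P >-> n.-tuple (observation R d k')})
    (psihat : Omega -> 'I_k -> R),
  (2 <= k)%N ->
  (* mu_a(x) = E(Y | X = x, A = a) and pi_a(x) = P(A = a | X = x) > 0 *)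
  is_cond_expectation Q (fun z => (cov z, trt z)) (@outcome R d k')
    (fun u => mu u.2 u.1) ->
  (forall a, is_cond_expectation Q (@cov R d k') (fun z => (trt z == a)%:R)
    (pi a)) ->
  (forall a, {ae Q, forall z, 0 < pi a (cov z)}) ->
  (forall a, ('E_Q[mu a \o cov] = (psi0 + psi a)%R%:E)%E) ->
  (l0norm psi <= s)%N ->
  independent_iid_samples P Q D1 D2 ->
  measurable_estimator muhat ->
  measurable_estimator pihat ->
  (forall a, {ae P, forall w, {ae Q, forall z,
    pihat a (D1 w) (cov z) != 0}}) ->
  (* (i) *)
  (forall a, c / k%:R <= treatment_prob Q a <= C / k%:R) ->
  (* (ii) *)
  (forall a, {ae P, forall w, {ae Q, forall z,
    `|treatment_freq (D1 w) a / pihat a (D1 w) (cov z)| <= B}}) ->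
  (* (iii) *)
  (forall a, {ae P, forall w, {ae Q, forall z,
    `|muhat a (D1 w) (cov z)| <= B}}) ->
  {ae Q, forall z, `|outcome z| <= B} ->
  `|psi0| <= B ->
  (* delta_n(a) <= delta_n and epsilon_n(a) <= epsilon_n *)
  (forall a, {ae P, forall w,
    (L2norm Q (fun x => pi a x / pihat a (D1 w) x - 1)%R <= deltan%:E)%E}) ->
  (forall a, {ae P, forall w,
    (L2norm Q (fun x => mu a x - muhat a (D1 w) x)%R <= epsn%:E)%E}) ->
  (forall a, measurable_fun [set: Omega] (fun w => psihat w a)) ->
  {ae P, forall w,
     lasso_argmin (l1norm psi)
       (empirical_risk psi0 muhat pihat (D1 w) (D2 w)) (psihat w)} \/
  {ae P, forall w,
     is_subset_estimate s (D2 w)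
       (empirical_risk psi0 muhat pihat (D1 w) (D2 w)) (psihat w)} ->
  Num.max (gamma * k%:R) (s%:R ^+ 4 / k%:R ^+ 2) * ln k%:R <= n%:R ->
  ('E_P[(fun w => \sum_(a < k) treatment_prob Q a
                     * (psihat w a - psi a) ^+ 2)%R]
     <= (K * (s%:R * (ln k%:R / n%:R)
              + s%:R / k%:R * (deltan * epsn) ^+ 2))%R%:E)%E].
Proof.
pose M := 2 * B ^+ 2 + 4 * B.
have M2 := sqr_ge0 M.
have c256 : 0 < 256 / c by rewrite divr_gt0 ?ltr0n.
exists (4 * M ^+ 2 + 4 + 256 / c), (rate_constant c C B); split.
- by lra.
- exact: rate_constant_gt0.
move=> k' n s d k Q mu pi psi0 psi muhat pihat deltan epsn dO Omega P D1 D2.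
move=> psihat k2 condmu condpi pi0 effect sparse iid mmuhat mpihat _ prob weight muhatB
  outcomeB psi0B perr rerr mpsihat est size.
have est' : {ae P, forall w,
  lasso_argmin (l1norm psi)
    (empirical_risk psi0 muhat pihat (D1 w) (D2 w)) (psihat w) \/
  is_subset_estimate s (D2 w)
    (empirical_risk psi0 muhat pihat (D1 w) (D2 w)) (psihat w)}.
  by case: est; apply: filterS => w h; [left|right].
have lnk0 : 0 < ln k%:R :> R.
  by apply: lt_le_trans (ln_nat_ge_half R k2); rewrite invr_gt0.
have size' : (4 * M ^+ 2 + 4 + 256 / c) * k%:R * ln k%:R <= n%:R.
  by apply: le_trans size; rewrite ler_wpM2r ?(ltW lnk0)// le_max lexx.
have [mbound bound0 boundle] := loss_bound_mean hc hC hB deltan epsn condmu condpi pi0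
  effect iid mmuhat mpihat prob weight muhatB outcomeB psi0B k2 size' s.
rewrite unlock; apply: le_trans boundle.
apply: ae_ge0_le_integral => //.
- move=> w _; rewrite lee_fin sumr_ge0// => a _.
  by rewrite mulr_ge0 ?sqr_ge0// (prob_ge0 hc prob).
- apply/measurable_EFinP; apply: measurable_sum => a.
  apply: measurable_funM => //; apply: measurable_funX.
  by apply: measurable_funB => //; exact: mpsihat.
- by move=> w _; rewrite lee_fin.
- exact/measurable_EFinP.
have := ae_loss_le_bound hc hC hB condmu condpi pi0 effect iid mmuhat mpihat
  prob weight muhatB outcomeB psi0B perr rerr k2 size' sparse est'.
by apply: filterS => w h _; rewrite lee_fin.
Qed.
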